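(* There is an absolute constant $c>0$ such that for every real number $\epsilon$ with $0<\epsilon<1/4$ there is a positive integer $n\ge c\,\epsilon^{-2}$ with $M(\epsilon)\ge T(n)$. That is, $M(\epsilon)$ is at least a tower of twos of height at least $c\epsilon^{-2}$.
   Context: Graphs are finite, simple and undirected. For nonempty vertex subsets $X,Y$ (not necessarily disjoint) of a graph $G=(V,E)$, let $e(X,Y)$ be the number of ordered pairs $(x,y)\in X\times Y$ such that $xy$ is an edge, and $d(X,Y)=\frac{e(X,Y)}{|X||Y|}$. The irregularity of the pair $X,Y$ is $\operatorname{irreg}(X,Y)=\max_{U\subset X,\,Z\subset Y}\bigl|e(U,Z)-|U||Z|d(X,Y)\bigr|$. The irregularity of a partition $\mathscr{P}$ of the vertex set (into nonempty parts) is $\operatorname{irreg}(\mathscr{P})=\sum_{X,Y\in\mathscr{P}}\operatorname{irreg}(X,Y)$, the sum being over all ordered pairs of parts, including $X=Y$. For $\epsilon>0$, $M(\epsilon)$ denotes the least positive integer such that every graph $G=(V,E)$ has a vertex partition into at most $M(\epsilon)$ parts with irregularity at most $\epsilon|V|^2$ (such an integer exists by Szemerédi's regularity lemma). The tower function is defined by $T(1)=2$ and $T(n)=2^{T(n-1)}$ for $n\ge 2$; $T(n)$ is the tower of twos of height $n$. *)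

(* Defs.v *)
From HB Require Import structures.
From mathcomp Require Import all_boot all_order all_algebra.
From mathcomp Require Import reals.

Set Implicit Arguments.
Unset Strict Implicit.
Unset Printing Implicit Defensive.

Import Order.TTheory GRing.Theory Num.Theory.

Local Open Scope ring_scope.

Record sgraph := SGraph {
  vertex :> finType;
  adj : rel vertex;
  adj_sym : symmetric adj;
  adj_irr : irreflexive adj }.

Section Irregularity.
Variables (R : realType) (G : sgraph).
Implicit Types (X Y U Z : {set G}) (P : {set {set G}}).

(* Ordered pairs: an edge inside X :&: Y is counted twice. *)
Definition edge_count X Y : nat :=
  #|[set p : G * G | [&& p.1 \in X, p.2 \in Y & adj p.1 p.2]]|.

Definition density X Y : R :=
  (edge_count X Y)%:R / (#|X|%:R * #|Y|%:R).

(* The maximum ranges over nonnegative numbers and a nonempty set of pairs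
   (U, Z), so the default value 0 does not affect it; an empty U or Z
   contributes 0. *)
Definition irreg X Y : R :=
  \big[Num.max/0]_(U : {set G} | U \subset X)
    \big[Num.max/0]_(Z : {set G} | Z \subset Y)
      `| (edge_count U Z)%:R - #|U|%:R * #|Z|%:R * density X Y |.

Definition irreg_partition P : R :=
  \sum_(X in P) \sum_(Y in P) irreg X Y.

End Irregularity.

Definition suffices (R : realType) (eps : R) (m : nat) : Prop :=
  forall G : sgraph, exists P : {set {set G}},
    [/\ partition P [set: G],
        (#|P| <= m)%N
      & irreg_partition R P <= eps * #|G|%:R ^+ 2].

(* [is_M eps m] says M(eps) = m. Such an m is unique, and for eps > 0 it
   exists by Szemeredi's regularity lemma; a relation is used so that the
   definition does not depend on a proof of that lemma. *)
Definition is_M (R : realType) (eps : R) (m : nat) : Prop :=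
  [/\ (0 < m)%N, suffices eps m
    & forall k : nat, (0 < k)%N -> suffices eps k -> (m <= k)%N].

(* Tower of n twos; starting from tower 0 = 1 gives tower 1 = 2 and
   tower n.+1 = 2 ^ tower n. *)
Definition tower (n : nat) : nat := iter n (expn 2) 1%N.

(* Main.v *)
(* Vertices carry nested partitions P_0, P_1, ..., P_s, each part X of P_j being
   split into exponentially many (in |P_j|) parts of P_(j+1).  Every part Y of
   P_j induces a bipartition of X, and the bipartitions seen by distinct parts
   of P_(j+1) inside X are nearly orthogonal.  The density between x and y
   starts at 1/2 and at each level moves by 1/(2K), up or down according to the
   two bipartitions, until it hits 0 or 1; since it is a random walk in y for
   each fixed x, s of order K^2 levels are possible.

   Let A be a part of a partition Q with few parts.  Testing A against all y
   with a function u of mean 0 on A bounds the irregularity from below.  The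
   contributions of the levels are martingale differences in y, so those of a
   range of levels cannot be cancelled by the others.  If A disperses gradually
   over the P_j, random signs for u give irregularity of order 1/K.  Otherwise A
   is concentrated in one part of some P_j and scattered over P_(j+1); then u is
   the bipartition of that part given by the part of P_j where B is
   concentrated, for all B dispersing no earlier than A, and the later levels
   contribute only little noise.  Comparing with the median level of dispersion
   covers a constant fraction of the pairs (A, B).  Hence the irregularity is of
   order |V|^2 / K unless Q has about as many parts as P_s. *)
Require Import Defs.
From HB Require Import structures.
From mathcomp Require Import all_boot all_order all_algebra.
From mathcomp Require Import reals.
From mathcomp Require Import ring lra zify.

Set Implicit Arguments.
Unset Strict Implicit.
Unset Printing Implicit Defensive.

Import Order.TTheory GRing.Theory Num.Theory.

Local Open Scope ring_scope.

(** * Random linear codes *)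

(** The tests of a pair measure an L1 norm over y, whereas near independence of the bipartitions
    controls moments. A second moment from below and a fourth moment from above together give an L1
    bound, hence the demand for cancellation up to fourth order ([lv_four]). Linear codes provide it
    exactly, and they reduce near orthogonality of two rows to the balance of a single row. The
    graph has to be symmetric, so the sign at level i is the product of [a i x y] and [a i y x]. For
    fixed x the first factor is constant in y on each part of level i and the second has mean 0
    there, so symmetry does not spoil the martingale property in y. The only probabilistic choice is
    that of the codes; all later averages run over vertices. The random signs are the columns of a
    later bipartition matrix, and rounding is made deterministic by giving the copies of a vertex
    all possible vectors of private random numbers. *)

Section Characters.
Variables (R : realFieldType) (k : nat).
Implicit Types l v : {ffun 'I_k -> bool}.

Definition chi l v : R := \prod_i (-1) ^+ (l i && v i).

Definition cube_add l l' : {ffun 'I_k -> bool} := [ffun i => l i (+) l' i].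

Lemma chiC l v : chi l v = chi v l.
Proof. by apply: eq_bigr => i _; rewrite andbC. Qed.

Lemma chi_sq l v : chi l v * chi l v = 1.
Proof.
rewrite /chi -big_split big1 //= => i _.
by rewrite -expr2 sqrr_sign.
Qed.

Lemma chi_val l v : chi l v = 1 \/ chi l v = -1.
Proof.
have /eqP := chi_sq l v; rewrite -expr2 sqrf_eq1 => /orP[] /eqP ->;
  by [left|right].
Qed.

Lemma chi_add l l' v : chi (cube_add l l') v = chi l v * chi l' v.
Proof.
rewrite /chi -big_split; apply: eq_bigr => i _ /=; rewrite ffunE.
by case: (l i) (l' i) (v i) => [] [] [] /=;
  rewrite ?expr0 ?expr1 ?mulr1 ?mul1r ?mulN1r ?opprK.
Qed.

Lemma sum_chi l : l != [ffun=> false] -> \sum_v chi l v = 0.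
Proof.
move=> l0; have [i li] : exists i, l i.
  apply/existsP; apply: contraNT l0 => /existsPn h.
  by apply/eqP/ffunP => i; rewrite ffunE; apply/negbTE/h.
have -> : \sum_v chi l v = \prod_j \sum_b (-1) ^+ (l j && b).
  by rewrite bigA_distr_bigA.
by rewrite (bigD1 i) //= big_bool li /= expr1 expr0 addNr mul0r.
Qed.

Lemma card_cube : #|{ffun 'I_k -> bool}| = (2 ^ k)%N.
Proof. by rewrite card_ffun card_bool card_ord. Qed.

(** One factor of an exponential moment: a nontrivial character takes both values equally often. *)
Lemma sum_tilted_chi (a b : R) l : l != [ffun=> false] ->
  \sum_v (if chi l v == 1 then a else b) = (2 ^ k)%:R * ((a + b) / 2).
Proof.
move=> l0.
have e v : (if chi l v == 1 then a else b) =
    (a + b) / 2 + chi l v * ((a - b) / 2).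
  have [->|->] := chi_val l v; first by rewrite eqxx /=; lra.
  by rewrite lt_eqF /=; lra.
rewrite (eq_bigr _ (fun v _ => e v)) big_split /=.
rewrite -[X in _ + X]mulr_suml sum_chi //.
by rewrite mul0r addr0 sumr_const card_cube [RHS]mulr_natl.
Qed.

Lemma chi0 v : chi [ffun=> false] v = 1.
Proof. by rewrite /chi big1 // => i _; rewrite ffunE. Qed.

Lemma prod_chi (I : Type) (xs : seq I) (c : I -> {ffun 'I_k -> bool}) l :
  \prod_(x <- xs) chi l (c x) =
  chi (foldr cube_add [ffun=> false] (map c xs)) l.
Proof.
elim: xs => [|x xs IH]; first by rewrite big_nil chi0.
by rewrite big_cons IH /= chi_add chiC.
Qed.

(** The product of the characters of the [c x] is the character of their sum, so the total detects
    whether that sum vanishes. *)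
Lemma sum_prod_chi (I : Type) (xs : seq I) (c : I -> {ffun 'I_k -> bool}) :
  \sum_l \prod_(x <- xs) chi l (c x) = 0 \/
  \sum_l \prod_(x <- xs) chi l (c x) = (2 ^ k)%:R.
Proof.
rewrite (eq_bigr _ (fun l _ => prod_chi xs c l)).
have [->|] := eqVneq (foldr cube_add [ffun=> false] (map c xs))
  [ffun=> false]; [right|by left; rewrite sum_chi].
rewrite (eq_bigr (fun=> 1)) => [|l _]; last by rewrite chi0.
by rewrite sumr_const card_cube.
Qed.

End Characters.

Lemma prod_seq_count (R : comRingType) (P : finType) (xs : seq P)
    (F : P -> R) :
  \prod_(x <- xs) F x = \prod_x F x ^+ count_mem x xs.
Proof.
elim: xs => [|y xs IH]; first by rewrite big_nil big1.
rewrite big_cons IH.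
under [RHS]eq_bigr => x _ do rewrite /= exprD.
rewrite big_split /=; congr (_ * _).
rewrite (bigD1 y) //= eqxx expr1 big1 ?mulr1 // => x xy.
by rewrite eq_sym (negbTE xy).
Qed.

(** * Codes with independent uniform random columns *)

Section Code.
Variables (R : realFieldType) (P : finType) (k : nat).

Local Notation cube := {ffun 'I_k -> bool}.
Local Notation Om := {ffun P -> cube}.

(** In characteristic 2 these are the lists whose columns do not cancel identically. *)
Definition has_odd_count (xs : seq P) := [exists x, odd (count_mem x xs)].

(** For nonzero [l] the factor of an entry of odd multiplicity averages to 0, so only [l] = 0
    survives. In effect the columns listed in [xs] sum to 0 with probability 2^-k. *)
Lemma sum_columns (xs : seq P) : has_odd_count xs ->
  \sum_(c : Om) \sum_l \prod_(x <- xs) chi R l (c x) = #|Om|%:R.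
Proof.
move=> /existsP[x0 ox0].
rewrite exchange_big (bigD1 [ffun=> false]) //= [X in _ + X]big1; last first.
  move=> l l0.
  under eq_bigr => c _ do rewrite prod_seq_count.
  have <- : \prod_x \sum_(v : cube) chi R l v ^+ count_mem x xs =
      \sum_(c : Om) \prod_x chi R l (c x) ^+ count_mem x xs.
    by rewrite bigA_distr_bigA.
  rewrite (bigD1 x0) //= (eq_bigr (chi R l)) ?sum_chi ?mul0r // => v _.
  rewrite -(odd_double_half (count_mem x0 xs)) ox0 exprS -mul2n exprM.
  by rewrite (expr2 (chi R l v)) chi_sq expr1n mulr1.
rewrite addr0 (eq_bigr (fun=> 1)) ?sumr_const // => c _.
by rewrite big1 // => x _; rewrite chi0.
Qed.

Lemma sum_tilted_rows (a b : R) (l : cube) : l != [ffun=> false] ->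
  \sum_(c : Om) \prod_x (if chi R l (c x) == 1 then a else b) =
  #|Om|%:R * ((a + b) / 2) ^+ #|P|.
Proof.
move=> l0.
have <- : \prod_(x : P) \sum_v (if chi R l v == 1 then a else b) =
    \sum_(c : Om) \prod_x (if chi R l (c x) == 1 then a else b).
  by rewrite bigA_distr_bigA.
rewrite sum_tilted_chi // prodr_const exprMn; congr (_ * _).
by rewrite card_ffun card_cube -natrX.
Qed.

(** The exponents 3 and 5 fit the threshold: a sum of signs above a quarter of its length has at
    least 5 values +1 for every 3 values -1. With base 17/16 the mean of [up] and [dn] is below
    97/100. *)
Local Notation sg := (17 / 16 : R).
Local Notation up := (sg ^+ 3).
Local Notation dn := ((sg ^+ 5)^-1).

Lemma tilted_ge1 (p n : nat) : (5 * n <= 3 * p)%N -> 1 <= up ^+ p * dn ^+ n.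
Proof.
move=> h; have sg1 : 1 <= sg by lra.
have sg0 : 0 < sg by lra.
rewrite exprVn -!exprM -(subnKC h) exprD mulrAC divff ?mul1r.
  by rewrite exprn_ege1.
by rewrite expf_neq0 // gt_eqF.
Qed.

Lemma sum_chi_card (F : P -> R) : (forall x, F x = 1 \/ F x = -1) ->
  \sum_x F x = #|[pred x | F x == 1]|%:R - #|[pred x | F x != 1]|%:R.
Proof.
move=> hF; rewrite (bigID [pred x | F x == 1]) /=.
rewrite (eq_bigr (fun=> 1)) => [|x /eqP //]; rewrite sumr_const.
congr (_ + _).
rewrite (eq_bigr (fun=> -1)) => [|x]; last by have [->|//] := hF x; rewrite eqxx.
by rewrite sumrN sumr_const.
Qed.

Lemma large_sum_tilted (F : P -> R) (neg : bool) :
  (forall x, F x = 1 \/ F x = -1) ->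
  #|P|%:R < 4 * ((-1) ^+ neg * \sum_x F x) ->
  1 <= \prod_x (if F x == 1 then (if neg then dn else up)
                else (if neg then up else dn)).
Proof.
move=> hF.
have cP : (#|[pred x | F x == 1%R]| + #|[pred x | F x != 1%R]|)%N = #|P|.
  exact: (cardC [pred x | F x == 1]).
rewrite (sum_chi_card hF) -cP natrD => h.
rewrite (bigID [pred x | F x == 1]) /=.
rewrite (eq_bigr (fun=> if neg then dn else up)) => [|x /= -> //].
rewrite prodr_const [X in _ <= _ * X](eq_bigr (fun=> if neg then up else dn));
  last by move=> x /negbTE ->.
rewrite prodr_const; move: h.
set p := #|_|; set n := #|_|.

case: neg => h; last first.
  by apply: tilted_ge1; rewrite -(ler_nat R) !natrM; lra.
by rewrite mulrC; apply: tilted_ge1; rewrite -(ler_nat R) !natrM; lra.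
Qed.

Hypothesis size_k : (2 + #|P| + #|P| ^ 4 < 2 ^ k)%N.
Hypothesis size_P : (64 * k <= #|P|)%N.

(** Chernoff weight, at least 1 whenever the sum of row [l], with sign [neg], exceeds a quarter of
    its length ([large_sum_tilted]). *)
Definition tilt (neg : bool) (l : cube) (c : Om) : R :=
  \prod_x (if chi R l (c x) == 1 then (if neg then dn else up)
                else (if neg then up else dn)).

(** The indicator that the columns listed in [xs] sum to 0. *)
Definition col (c : Om) (xs : seq P) : R :=
  (2 ^ k)%:R^-1 * \sum_l \prod_(x <- xs) chi R l (c x).

Local Notation quads := {ffun 'I_4 -> P}.

(** The nonnegative summands dominate the indicators of the violated requirements, so [bad c < 1]
    leaves none violated. *)
Definition bad (c : Om) : R :=
  \sum_(l | l != [ffun=> false]) (tilt true l c + tilt false l c) +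
  (\sum_(q : quads | has_odd_count (codom q)) col c (codom q) +
   \sum_x col c [:: x]).

Lemma sum_tilt neg : \sum_(l | l != [ffun=> false]) \sum_c tilt neg l c <=
  #|Om|%:R * (2 ^ k)%:R^-1.
Proof.
have k2 : (0 : R) < (2 ^ k)%:R by rewrite ltr0n expn_gt0.
have b97 : (up + dn) / 2 <= (97 / 100 : R) by lra.
have b0 : 0 <= (up + dn) / 2 :> R by lra.
have hl l : l != [ffun=> false] ->
    \sum_c tilt neg l c <= #|Om|%:R * (4 ^+ k)^-1.
  move=> l0; rewrite /tilt sum_tilted_rows //.
  have -> : (if neg then dn else up) + (if neg then up else dn) = up + dn.
    by case: neg => //; rewrite addrC.
  rewrite ler_wpM2l ?ler0n //.
  have -> : #|P| = (64 * k + (#|P| - 64 * k))%N by rewrite subnKC.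
  rewrite exprD -[leRHS]mulr1 ler_pM ?exprn_ge0 ?exprn_ile1 //; last first.
    by apply: le_trans b97 _; lra.
  (* The 64th power of 97/100 is below 1/4, so 64k columns beat a union over 2^k rows. Intermediate
     powers are rounded up to keep the numerals small. *)
  rewrite exprM -exprVn lerXn2r ?nnegrE ?exprn_ge0 ?invr_ge0 //.
  apply: (@le_trans _ _ ((97 / 100) ^+ 64)).
    by rewrite lerXn2r ?nnegrE //; lra.
  have h2 : (97 / 100 : R) ^+ 2 <= 95 / 100 by lra.
  have h16 : (97 / 100 : R) ^+ 16 <= 67 / 100.
    rewrite (exprM _ 2 8); apply: (@le_trans _ _ ((95 / 100) ^+ 8)).
      by rewrite lerXn2r ?nnegrE //; lra.
    by lra.
  rewrite (exprM _ 16 4); apply: (@le_trans _ _ ((67 / 100) ^+ 4)).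
    by rewrite lerXn2r ?nnegrE //; lra.
  by lra.
apply: le_trans (ler_sum _ hl) _.
rewrite sumr_const -[leLHS]mulr_natr -mulrA ler_wpM2l ?ler0n //.
rewrite -(ler_pM2r k2) mulVf ?gt_eqF // -mulrA -natrM.
rewrite mulrC ler_pdivrMr ?exprn_gt0 ?ltr0n // mul1r.
rewrite -(natrX _ 4 k) ler_nat -[4%N]/(2 * 2)%N expnMn.
rewrite leq_mul2r; apply/orP; right; rewrite -card_cube; exact: max_card.
Qed.

Lemma sum_col xs : has_odd_count xs ->
  \sum_c col c xs = #|Om|%:R * (2 ^ k)%:R^-1.
Proof. by move=> h; rewrite -mulr_sumr sum_columns // mulrC. Qed.

Lemma odd_count1 (x : P) : has_odd_count [:: x].
Proof. by apply/existsP; exists x; rewrite /= eqxx. Qed.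

(** The mean of [bad] is at most 2^-k times 2 + |P| + |P|^4, counting two tilts, the single columns
    and the quadruples. *)
Lemma exists_good_columns : exists c, bad c < 1.
Proof.
have k2 : (0 : R) < (2 ^ k)%:R by rewrite ltr0n expn_gt0.
apply/existsP; apply: contraT => /existsPn h.
have : \sum_(c : Om) (1 : R) <= \sum_c bad c.
  by apply: ler_sum => c _; rewrite leNgt; exact: h.
suff : \sum_c bad c < \sum_(c : Om) (1 : R) by move=> /lt_le_trans H /H; rewrite ltxx.
rewrite sumr_const /bad !big_split /=.
rewrite exchange_big [X in _ + (X + _)]exchange_big
  [X in _ + (_ + X)]exchange_big /=.
under eq_bigr => l _ do rewrite big_split /=.
rewrite big_split /=.
rewrite [X in _ + (X + _)](eq_bigr (fun=> #|Om|%:R * (2 ^ k)%:R^-1));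
  last by move=> q hq; rewrite sum_col.
rewrite [X in _ + (_ + X)](eq_bigr (fun=> #|Om|%:R * (2 ^ k)%:R^-1));
  last by move=> x _; rewrite sum_col // odd_count1.
rewrite !sumr_const.
have Om0 : (0 : R) < #|Om|%:R by rewrite ltr0n card_ffun expn_gt0 card_cube expn_gt0.
set z := _ * _^-1 in |- *.
have z0 : 0 < z by rewrite mulr_gt0 ?invr_gt0.
apply: (@le_lt_trans _ _ (z *+ (2 + #|P| + #|P| ^ 4))).
  rewrite -addnA mulrnDr lerD //.
    by rewrite mulr2n lerD // sum_tilt.
  rewrite addnC mulrnDr lerD // ler_wpMn2l ?ltW //.
  have -> : (#|P| ^ 4)%N = #|quads| by rewrite card_ffun card_ord.
  exact: max_card.
rewrite -mulr_natr /z -mulrA -[ltRHS]mulr1 ltr_pM2l // mulrC ltr_pdivrMr //.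
by rewrite mul1r ltr_nat.
Qed.

Lemma tilt_ge0 neg l c : 0 <= tilt neg l c.
Proof.
by apply: prodr_ge0 => x _; case: ifP; case: (neg) => _; lra.
Qed.

Lemma col_val c xs : col c xs = 0 \/ col c xs = 1.
Proof.
rewrite /col; have [->|->] := sum_prod_chi R xs c; first by rewrite mulr0; left.
by right; rewrite mulVf // pnatr_eq0 expn_eq0.
Qed.

Lemma col_ge0 c xs : 0 <= col c xs.
Proof. by have [->|->] := col_val c xs; rewrite ?ler01. Qed.

(* Take a random linear code: the expected number of violated requirements,
   bounded by [bad], is less than 1. *)
Lemma code_exists : exists H : cube -> P -> R,
  [/\ forall l x, H l x * H l x = 1,
      forall x, \sum_l H l x = 0,
      forall q : {ffun 'I_4 -> P}, has_odd_count (codom q) ->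
        \sum_l \prod_(x <- codom q) H l x = 0
    & forall l l', l != l' ->
        `|\sum_x H l x * H l' x| * 4 <= #|P|%:R].
Proof.
have [c hc] := exists_good_columns.
have tsum : 0 <= \sum_(l | l != [ffun=> false]) (tilt true l c + tilt false l c).
  by apply: sumr_ge0 => l _; rewrite addr_ge0 ?tilt_ge0.
have qsum : 0 <= \sum_(q : quads | has_odd_count (codom q)) col c (codom q).
  by apply: sumr_ge0 => l _; rewrite col_ge0.
have xsum : 0 <= \sum_x col c [:: x].
  by apply: sumr_ge0 => l _; rewrite col_ge0.
have colz xs : col c xs < 1 -> \sum_l \prod_(x <- xs) chi R l (c x) = 0.
  rewrite /col; have [->//|->] := sum_prod_chi R xs c.
  by rewrite mulVf ?ltxx // pnatr_eq0 expn_eq0.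
exists (fun l x => chi R l (c x)); split.
- by move=> l x; rewrite chi_sq.
- move=> x; have := colz [:: x]; under eq_bigr do rewrite big_seq1; apply.
  have : col c [:: x] <= \sum_x col c [:: x].
    by rewrite (bigD1 x) //= lerDl sumr_ge0 // => y _; rewrite col_ge0.
  by move: hc; rewrite /bad; lra.
- move=> q oq; apply: colz.
  have : col c (codom q) <= \sum_(q : quads | has_odd_count (codom q)) col c (codom q).
    by rewrite (bigD1 q) //= lerDl sumr_ge0 // => y _; rewrite col_ge0.
  by move: hc; rewrite /bad; lra.
- move=> l l' ll'.
  (* By linearity the product of the rows [l] and [l'] is the row of their nonzero sum. *)
  have l0 : cube_add l l' != [ffun=> false].
    apply: contraNneq ll' => /ffunP h; apply/eqP/ffunP => i.
    by have := h i; rewrite !ffunE; case: (l i) (l' i) => [] [].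
  under eq_bigr => x _ do rewrite -chi_add.
  set F := fun x => chi R (cube_add l l') (c x).
  have hF x : F x = 1 \/ F x = -1 by apply: chi_val.
  have small neg : tilt neg (cube_add l l') c < 1.
    have : tilt true (cube_add l l') c + tilt false (cube_add l l') c <=
        \sum_(l | l != [ffun=> false]) (tilt true l c + tilt false l c).
      rewrite (bigD1 (cube_add l l')) //= lerDl sumr_ge0 // => y _.
      by rewrite addr_ge0 ?tilt_ge0.
    have := tilt_ge0 true (cube_add l l') c.
    have := tilt_ge0 false (cube_add l l') c.
    by move: hc; rewrite /bad; case: neg; lra.
  have h (neg : bool) : 4 * ((-1) ^+ neg * \sum_x F x) <= #|P|%:R.
    rewrite leNgt; apply/negP => hlt.
    by have := large_sum_tilted hF hlt; rewrite leNgt small.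
  have := h true; have := h false; rewrite expr0 expr1.
  by case: (ger0P (\sum_x F x)) => _; lra.
Qed.

End Code.

(** * Nested partitions *)

Definition paired (T : Type) (e : rel T) x1 x2 x3 x4 :=
  [|| e x1 x2 && e x3 x4, e x1 x3 && e x2 x4 | e x1 x4 && e x2 x3].

Lemma unpaired_odd_count (P : finType) (x1 x2 x3 x4 : P) :
  ~~ paired eq_op x1 x2 x3 x4 -> has_odd_count [:: x1; x2; x3; x4].
Proof.
rewrite /paired => h; apply/existsP => /=.
have [e12|n12] := eqVneq x1 x2.
  exists x3; move: h; rewrite -e12 !eqxx.
  by case: (eqVneq x3 x4) => //= _ _; rewrite addn0; case: eqP.
have [e13|n13] := eqVneq x1 x3.
  exists x2; move: h; rewrite -e13 !eqxx /=.
  rewrite (negbTE n12) [x4 == x2]eq_sym /=.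
  by case: (eqVneq x2 x4).
have [e14|n14] := eqVneq x1 x4.
  exists x2; move: h; rewrite -e14 !eqxx (negbTE n12) (negbTE n13) /=.
  by rewrite [x3 == x2]eq_sym; case: (eqVneq x2 x3).
exists x1; rewrite eqxx [x2 == x1]eq_sym [x3 == x1]eq_sym [x4 == x1]eq_sym.
by rewrite (negbTE n12) (negbTE n13) (negbTE n14).
Qed.

Lemma code_exists4 (R : realFieldType) (P : finType) (k : nat) :
  (2 + #|P| + #|P| ^ 4 < 2 ^ k)%N -> (64 * k <= #|P|)%N ->
  exists H : {ffun 'I_k -> bool} -> P -> R,
  [/\ forall l x, H l x * H l x = 1,
      forall x, \sum_l H l x = 0,
      forall x1 x2 x3 x4, ~~ paired eq_op x1 x2 x3 x4 ->
        \sum_l H l x1 * H l x2 * H l x3 * H l x4 = 0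
    & forall l l', l != l' ->
        `|\sum_x H l x * H l' x| * 4 <= #|P|%:R].
Proof.
move=> hk hP; have [H [H1 H2 H3 H4]] := code_exists R hk hP.
exists H; split=> // x1 x2 x3 x4 /unpaired_odd_count h.
have := H3 [ffun i => tnth [tuple x1; x2; x3; x4] i].
have -> : codom [ffun i => tnth [tuple x1; x2; x3; x4] i] =
    [:: x1; x2; x3; x4].
  rewrite codomE -[RHS](map_tnth_enum [tuple x1; x2; x3; x4]).
  by apply: eq_map => i; rewrite ffunE.
move=> /(_ h) h0; rewrite -[RHS]h0; apply: eq_bigr => l _.
by rewrite !big_cons big_nil mulr1 !mulrA.
Qed.

Definition inv (T : Type) (S : Type) (r : rel T) (phi : T -> S) :=
  forall y y', r y y' -> phi y = phi y'.

(* [e i x y]: the vertices x and y lie in the same part of the i-th partition.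
   [a i x y]: on which side of its part x lies in the bipartition of that part
   which is associated with the part of y. *)
Record level_ok (R : realFieldType) (T : finType) (e : nat -> rel T)
    (a : nat -> T -> T -> R) (s : nat) : Prop := LevelOk {
  lv_refl : forall i x, e i x x;
  lv_sym : forall i x y, e i x y = e i y x;
  lv_trans : forall i x y z, e i x y -> e i y z -> e i x z;
  lv_sub : forall i x y, (i < s)%N -> e i.+1 x y -> e i x y;
  lv_sq : forall i x y, a i x y * a i x y = 1;
  lv_inv : forall i x x' y y', (i < s)%N -> e i.+1 x x' -> e i y y' ->
    a i x y = a i x' y';
  lv_mean : forall i (phi : T -> R) x, (i < s)%N -> inv (e i) phi ->
    \sum_y phi y * a i y x = 0;
  lv_four : forall i (phi : T -> R) x1 x2 x3 x4, (i < s)%N -> inv (e i) phi ->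
    ~~ paired (e i) x1 x2 x3 x4 ->
    \sum_y phi y * (a i y x1 * a i y x2 * a i y x3 * a i y x4) = 0;
  lv_row : forall i x x', (i < s)%N -> e i x x' -> ~~ e i.+1 x x' ->
    `|\sum_y a i x y * a i x' y| * 4 <= #|T|%:R }.

Lemma sum_prod_type (R : realFieldType) (T U : finType) (f : T * U -> R) :
  \sum_y f y = \sum_y1 \sum_y2 f (y1, y2).
Proof. by rewrite pair_big; apply: eq_bigr => -[]. Qed.

(** A blow-up: replacing each vertex by equally many copies only rescales the averages. *)
Lemma level_lift (R : realFieldType) (T U : finType) e a s :
  @level_ok R T e a s ->
  level_ok (fun i (x y : T * U) => e i x.1 y.1)
           (fun i (x y : T * U) => a i x.1 y.1) s.
Proof.
move=> L; split.
- by move=> i x; apply: (lv_refl L).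
- by move=> i x y; apply: (lv_sym L).
- by move=> i x y z; apply: (lv_trans L).
- by move=> i x y; apply: (lv_sub L).
- by move=> i x y; apply: (lv_sq L).
- by move=> i x x' y y'; apply: (lv_inv L).
- move=> i phi x si hphi; rewrite sum_prod_type exchange_big big1 // => u _ /=.
  by apply: (lv_mean L (phi := fun y => phi (y, u))) => // y y' yy'; apply: hphi.
- move=> i phi x1 x2 x3 x4 si hphi hx.
  rewrite sum_prod_type exchange_big big1 // => u _ /=.
  by apply: (lv_four L (phi := fun y => phi (y, u))) => // y y' yy'; apply: hphi.
- move=> i x x' si h1 h2; rewrite sum_prod_type /=.
  under eq_bigr => y _ do rewrite sumr_const.
  rewrite sumrMnl normrMn mulrnAl card_prod natrM [leRHS]mulr_natr.
  by rewrite lerMn2r (lv_row L) // orbT.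
Qed.

(** A part of level s is a single vertex of [T]. It is split into one part per code word, and the
    word of a new part gives its side in each of the bipartitions. *)
Lemma level_step (R : realFieldType) (T L : finType) e a s (H : L -> T -> R) :
  @level_ok R T e a s -> (forall x y, e s x y = (x == y)) ->
  (forall l x, H l x * H l x = 1) ->
  (forall x, \sum_l H l x = 0) ->
  (forall x1 x2 x3 x4, ~~ paired eq_op x1 x2 x3 x4 ->
        \sum_l H l x1 * H l x2 * H l x3 * H l x4 = 0) ->
  (forall l l', l != l' -> `|\sum_x H l x * H l' x| * 4 <= #|T|%:R) ->
  level_ok (fun i (x y : T * L) => if (i <= s)%N then e i x.1 y.1 else x == y)
           (fun i (x y : T * L) => if (i < s)%N then a i x.1 y.1 else H x.2 y.1)
           s.+1.
Proof.
move=> Lv es H1 H2 H3 H4; have Lf := level_lift L Lv; split.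
- by move=> i x; case: ifP => _; rewrite ?(lv_refl Lv).
- by move=> i x y; case: ifP => _; rewrite 1?(lv_sym Lv) 1?eq_sym.
- move=> i x y z; case: ifP => _; first exact: (lv_trans Lv).
  by move=> /eqP ->.
- move=> i x y; rewrite ltnS => si; rewrite si; case: ltnP => [si'|].
    exact: (lv_sub Lv).
  by move=> _ /eqP ->; rewrite (lv_refl Lv).
- by move=> i x y; case: ifP => _; rewrite ?(lv_sq Lv) ?H1.
- move=> i x x' y y'; rewrite ltnS => si; rewrite si.
  case: ltnP => [si'|si']; first exact: (lv_inv Lv).
  have -> : i = s by apply/eqP; rewrite eqn_leq si.
  by move=> /eqP ->; rewrite es => /eqP ->.
- move=> i phi x; rewrite ltnS => si; rewrite si.
  case: ltnP => [si' hphi|si']; first exact: (lv_mean Lf).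
  have -> : i = s by apply/eqP; rewrite eqn_leq si.
  move=> hphi; rewrite sum_prod_type big1 // => y _ /=.
  have hy l : phi (y, l) = phi (y, x.2) by apply: hphi; rewrite es.
  by under eq_bigr => l _ do rewrite hy; rewrite -mulr_sumr H2 mulr0.
- move=> i phi x1 x2 x3 x4; rewrite ltnS => si; rewrite si.
  case: ltnP => [si' hphi|si']; first exact: (lv_four Lf).
  have -> : i = s by apply/eqP; rewrite eqn_leq si.
  move=> hphi hx; rewrite sum_prod_type big1 // => y _ /=.
  have hy l : phi (y, l) = phi (y, x1.2) by apply: hphi; rewrite es.
  under eq_bigr => l _ do rewrite hy.
  by rewrite -mulr_sumr H3 ?mulr0 //; move: hx; rewrite /paired !es.
- move=> i x x'; rewrite ltnS => si; rewrite si.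
  case: ltnP => [si'|si']; first exact: (lv_row Lf).
  have -> : i = s by apply/eqP; rewrite eqn_leq si.
  rewrite es => /eqP x1 x2.
  have ne : x.2 != x'.2.
    by apply: contraNneq x2 => x2; apply/eqP; case: x x' x1 x2 => ? ? [? ?] /= -> ->.
  rewrite sum_prod_type /=; under eq_bigr => y _ do rewrite sumr_const.
  rewrite sumrMnl normrMn mulrnAl card_prod natrM [leRHS]mulr_natr.
  by rewrite lerMn2r H4 // orbT.
Qed.

(** Codes of dimension k = m / 64 on m parts respect the requirement [64 * k <= m] of the Chernoff
    bound and still give exponential growth. *)
Fixpoint level_size (m0 s : nat) : nat :=
  if s is s'.+1 then (level_size m0 s' * 2 ^ (level_size m0 s' %/ 64))%N else m0.

Lemma level_size_ge m0 s : (m0 <= level_size m0 s)%N.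
Proof.
elim: s => [|s IH] //=; apply: leq_trans IH _.
by rewrite leq_pmulr // expn_gt0.
Qed.

Lemma levels_exist (R : realFieldType) (m0 : nat) :
  (forall m, (m0 <= m)%N -> (2 + m + m ^ 4 < 2 ^ (m %/ 64))%N) ->
  forall s, exists (T : finType) (e : nat -> rel T) (a : nat -> T -> T -> R)
    (c : T -> 'I_m0),
  [/\ level_ok e a s, #|T| = level_size m0 s,
      forall x y, e s x y = (x == y) & forall x y, e 0%N x y = (c x == c y)].
Proof.
move=> hm; elim=> [|s [T [e [a [c [L cT es e0]]]]]].
  exists 'I_m0, (fun _ x y => x == y), (fun _ _ _ => 1), id.
  split=> //; last by rewrite card_ord.
  split=> //.
  - by move=> _ x y z /eqP ->.
  - by move=> *; rewrite mulr1.
have hT : (m0 <= #|T|)%N by rewrite cT level_size_ge.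
have [H [H1 H2 H3 H4]] := code_exists4 R (hm _ hT)
  (leq_trans (eq_leq (mulnC _ _)) (leq_divM _ _)).
eexists _, _, _, (fun x => c x.1); split; first exact: (level_step L es H1 H2 H3 H4).
- by rewrite card_prod card_cube cT.
- by move=> x y /=; rewrite ltnn.
- by move=> x y /=; rewrite e0.
Qed.

(** * The stopped walk *)

Section Walk.
Variables (R : realFieldType) (V : finType).
Variables (e : nat -> rel V) (a : nat -> V -> V -> R) (s K : nat).
Hypothesis L : level_ok e a s.
Hypothesis K0 : (0 < K)%N.
Implicit Types (x y : V) (i j n : nat) (c C : V -> V -> R) (b psi : V -> R).

Local Notation N := (#|V|%:R : R).

Definition step i x y := a i x y * a i y x.

(* The stopping at K or -K keeps the density 1/2 + walk/(2K) in [0, 1]. *)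
Fixpoint walk n x y : R :=
  if n is n'.+1 then
    walk n' x y + (`|walk n' x y| < K%:R)%R%:R * step n' x y
  else 0.

Definition live n x y : R := (`|walk n x y| < K%:R)%R%:R.

Arguments walk : simpl never.

Lemma walkS n x y : walk n.+1 x y = walk n x y + live n x y * step n x y.
Proof. by []. Qed.

Lemma step_sym i x y : step i x y = step i y x.
Proof. exact: mulrC. Qed.

Lemma walk_sym n x y : walk n x y = walk n y x.
Proof.
elim: n => // n IH; by rewrite !walkS /live IH step_sym.
Qed.

Lemma same_part_le i j x y : (i <= j)%N -> (j <= s)%N -> e j x y -> e i x y.
Proof.
elim: j => [|j IH]; first by rewrite leqn0 => /eqP ->.
rewrite leq_eqVlt => /orP[/eqP -> //|]; rewrite ltnS => ij js h.
by apply: IH => //; [apply: ltnW|apply: (lv_sub L)].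
Qed.

Lemma inv_le (S : Type) i j (phi : V -> S) : (i <= j)%N -> (j <= s)%N ->
  inv (e i) phi -> inv (e j) phi.
Proof. by move=> ij js h y y' /(same_part_le ij js); apply: h. Qed.

Lemma walk_inv n x x' y y' : (n <= s)%N -> e n x x' -> e n y y' ->
  walk n x y = walk n x' y'.
Proof.
elim: n x x' y y' => [//|n IH] x x' y y' ns xx yy; rewrite !walkS /live.
have xx0 := lv_sub L ns xx; have yy0 := lv_sub L ns yy.
rewrite (IH _ x' _ y') ?(ltnW ns) //; congr (_ + _ * _).
rewrite /step (lv_inv L ns xx yy0); congr (_ * _).
by apply: (lv_inv L ns yy xx0).
Qed.

Lemma live_inv n x x' y y' : (n <= s)%N -> e n x x' -> e n y y' ->
  live n x y = live n x' y'.
Proof. by move=> ns xx yy; rewrite /live (walk_inv ns xx yy). Qed.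

Lemma sign_val i x y : a i x y = 1 \/ a i x y = -1.
Proof.
have /eqP := lv_sq L i x y; rewrite -expr2 sqrf_eq1 => /orP[] /eqP ->;
  by [left|right].
Qed.

Lemma norm_sign i x y : `|a i x y| = 1.
Proof. by have [->|->] := sign_val i x y; rewrite ?normrN normr1. Qed.

Lemma live_ge0 n x y : 0 <= live n x y.
Proof. exact: ler0n. Qed.

Lemma live_le1 n x y : live n x y <= 1.
Proof. by rewrite /live; case: (_ < _); rewrite ?ler01. Qed.

Lemma live_sq n x y : live n x y * live n x y = live n x y.
Proof. by rewrite /live; case: (_ < _); rewrite ?mulr1 ?mulr0. Qed.

(** The density is thus an exact multiple of 1/(2K), which a uniform residue mod 2K can realise. *)
Lemma walk_shift_nat n x y :
  exists2 p : nat, (p <= 2 * K)%N & walk n x y + K%:R = p%:R.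
Proof.
elim: n => [|n [p pK hp]]; first by exists K; rewrite ?leq_pmull //; apply: add0r.
rewrite walkS /live.
have -> : walk n x y = p%:R - K%:R by rewrite -hp addrK.
case: ltrP => h; last by exists p => //; rewrite mul0r addr0 subrK.
have [p0 p2] : (0 < p)%N /\ (p < 2 * K)%N.
  move: h; rewrite ltr_norml => /andP[h1 h2].
  have h1' : (0 : R) < p%:R by lra.
  have h2' : (p%:R : R) < (2 * K)%:R by rewrite natrM; lra.
  by move: h1' h2'; rewrite ltr0n ltr_nat.
rewrite mul1r /step.
have [-> | ->] : a n x y * a n y x = 1 \/ a n x y * a n y x = -1.
  have [->|->] := sign_val n x y; have [->|->] := sign_val n y x;
  rewrite ?mulr1 ?mulrN1 ?opprK; by [left|right].
  by exists p.+1 => //; rewrite -natr1; lra.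
exists p.-1; first by lia.
by rewrite -[p in LHS](prednK p0) -natr1; lra.
Qed.

Lemma walk_stopped i j x y : (i <= j)%N -> live i x y = 0 ->
  walk j x y = walk i x y.
Proof.
move=> /subnKC <-; elim: (j - i)%N => [|d IH] h; first by rewrite addn0.
rewrite addnS walkS IH //.
have -> : live (i + d) x y = live i x y by rewrite /live IH.
by rewrite h mul0r addr0.
Qed.

Lemma sum_walk2 n x : (n <= s)%N -> \sum_y walk n x y ^+ 2 <= n%:R * N.
Proof.
elim: n => [|n IH] ns.
  by rewrite mul0r big1 // => y _; rewrite expr0n.
(* The cross term of the square vanishes: the bracket is constant in y on parts of level n, and
   [a n y x] has mean 0 on them. *)
have h0 : \sum_y (walk n x y * live n x y * a n x y) * a n y x = 0.
  apply: (lv_mean L) => // y y' yy.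
  rewrite (walk_inv (ltnW ns) (lv_refl L n x) yy).
  rewrite (live_inv (ltnW ns) (lv_refl L n x) yy).
  by rewrite (lv_inv L ns (lv_refl L _ x) yy).
have -> : \sum_y walk n.+1 x y ^+ 2 = \sum_y walk n x y ^+ 2 +
    2 * \sum_y (walk n x y * live n x y * a n x y) * a n y x +
    \sum_y live n x y.
  rewrite mulr_sumr -!big_split /=; apply: eq_bigr => y _.
  have := lv_sq L n x y; have := lv_sq L n y x; have := live_sq n x y.
  rewrite walkS /step.
  move: (walk n x y) (live n x y) (a n x y) (a n y x) => w l u v hl hv hu.
  have -> : (w + l * (u * v)) ^+ 2 =
    w ^+ 2 + 2 * (w * l * u * v) + (l * l) * (u * u) * (v * v) by ring.
  by rewrite hl hv hu !mulr1.
rewrite h0 mulr0 addr0 -natr1 mulrDl mul1r lerD ?IH ?(ltnW ns) //.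
apply: (@le_trans _ _ (\sum_(y : V) 1)); last by rewrite sumr_const.
by apply: ler_sum => y _; exact: live_le1.
Qed.

(** Chebyshev's inequality at time s: a walk stopped by time n keeps absolute value at least K. *)
Lemma sum_stopped n x : (n <= s)%N ->
  \sum_y (1 - live n x y) <= s%:R / K%:R ^+ 2 * N.
Proof.
move=> ns; have K2 : (0 : R) < K%:R ^+ 2 by rewrite exprn_gt0 // ltr0n.
apply: (@le_trans _ _ (\sum_y walk s x y ^+ 2 / K%:R ^+ 2)); last first.
  rewrite -mulr_suml mulrAC ler_pM2r ?invr_gt0 //.
  exact: sum_walk2.
apply: ler_sum => y _; rewrite ler_pdivlMr //.
have [h|h] : live n x y = 0 \/ live n x y = 1.
  by rewrite /live; case: (_ < _); [right|left].
  rewrite h subr0 mul1r (walk_stopped ns h).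
  move: h; rewrite /live; case: ltrP => [_ /eqP|h _]; first by rewrite oner_eq0.
  by rewrite -(real_normK (num_real (walk n x y))) lerXn2r ?nnegrE ?ler0n.
by rewrite h subrr mul0r sqr_ge0.
Qed.

(** For a probability weight [b], the chance that two independent points lie in a common part of
    level i. *)
Definition collision i b := \sum_x \sum_x' b x * b x' * (e i x x')%:R.

Lemma collision_ge0 i b : (forall x, 0 <= b x) -> 0 <= collision i b.
Proof.
by move=> h; do 2 apply: sumr_ge0 => ? _; rewrite !mulr_ge0.
Qed.

(** The quadruple x, x', x, x is unpaired, and its product of signs is that of x and x'. *)
Lemma lv_pair i psi x x' : (i < s)%N -> inv (e i) psi -> ~~ e i x x' ->
  \sum_y psi y * (a i y x * a i y x') = 0.
Proof.
move=> si hpsi nxx.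
rewrite -[RHS](lv_four L si hpsi (x1 := x) (x2 := x') (x3 := x) (x4 := x)).
  by apply: eq_bigr => y _; rewrite -!mulrA (lv_sq L) mulr1.
rewrite /paired !(lv_refl L) (negbTE nxx) /=.
by rewrite (lv_sym L i x' x) (negbTE nxx).
Qed.

Lemma moment2 i C psi : (i < s)%N -> (forall x, inv (e i) (C x)) ->
  inv (e i) psi ->
  \sum_y psi y * (\sum_x C x y * a i y x) ^+ 2 =
  \sum_y psi y * \sum_x \sum_x' C x y * C x' y * (e i x x')%:R.
Proof.
move=> si hC hpsi.
transitivity (\sum_x \sum_x' \sum_y
   psi y * (C x y * C x' y) * (a i y x * a i y x')).
  under [RHS]eq_bigr => x _ do rewrite exchange_big.
  rewrite [RHS]exchange_big; apply: eq_bigr => y _ /=.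
  rewrite expr2 big_distrlr mulr_sumr; apply: eq_bigr => x _.
  by rewrite mulr_sumr; apply: eq_bigr => x' _ /=; ring.
transitivity (\sum_x \sum_x' \sum_y
   psi y * (C x y * C x' y * (e i x x')%:R)).
  apply: eq_bigr => x _; apply: eq_bigr => x' _.
  have [exx|nxx] := boolP (e i x x').
    apply: eq_bigr => y _; rewrite mulr1.
    have -> : a i y x' = a i y x.
      by apply: (lv_inv L) => //; rewrite ?(lv_refl L) // (lv_sym L).
    by rewrite (lv_sq L) mulr1.
  rewrite [RHS]big1 => [|y _]; last by rewrite !mulr0.
  apply: lv_pair => // y y' yy.
  by rewrite (hpsi _ _ yy) (hC x _ _ yy) (hC x' _ _ yy).
under eq_bigr => x _ do rewrite exchange_big.
rewrite exchange_big; apply: eq_bigr => y _ /=.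
by rewrite mulr_sumr; apply: eq_bigr => x _; rewrite mulr_sumr.
Qed.

Lemma paired_le i x1 x2 x3 x4 : ((paired (e i) x1 x2 x3 x4)%:R : R) <=
  (e i x1 x2)%:R * (e i x3 x4)%:R + (e i x1 x3)%:R * (e i x2 x4)%:R +
  (e i x1 x4)%:R * (e i x2 x3)%:R.
Proof.
rewrite /paired -!natrM -!natrD ler_nat.
by case: (e i x1 x2) (e i x3 x4) (e i x1 x3) (e i x2 x4) (e i x1 x4)
  (e i x2 x3) => [] [] [] [] [] [].
Qed.

(** Only quadruples matched in pairs within parts of level i survive; the 3 counts the matchings. *)
Lemma moment4 i C b : (i < s)%N -> (forall x, inv (e i) (C x)) ->
  (forall x y, `|C x y| <= b x) ->
  \sum_y (\sum_x C x y * a i y x) ^+ 4 <= 3 * collision i b ^+ 2 * N.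
Proof.
move=> si hC Cb.
have b0 x : 0 <= b x by apply: le_trans (Cb x x).
have -> : \sum_y (\sum_x C x y * a i y x) ^+ 4 =
    \sum_x1 \sum_x2 \sum_x3 \sum_x4 \sum_y
      (C x1 y * C x2 y * C x3 y * C x4 y) *
      (a i y x1 * a i y x2 * a i y x3 * a i y x4).
  under [RHS]eq_bigr => x1 _ do (under eq_bigr => x2 _ do
    (under eq_bigr => x3 _ do rewrite exchange_big; rewrite exchange_big);
    rewrite exchange_big).
  rewrite [RHS]exchange_big; apply: eq_bigr => y _ /=.
  rewrite -[4%N]/(2 * 2)%N exprM !expr2 big_distrlr /= big_distrlr /=.
  under eq_bigr => x1 _ do (under eq_bigr => x3 _ do rewrite big_distrlr /=;
    rewrite exchange_big /=).
  apply: eq_bigr => x1 _; apply: eq_bigr => x2 _; apply: eq_bigr => x3 _.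
  by apply: eq_bigr => x4 _; ring.
have h4 x1 x2 x3 x4 : \sum_y
      (C x1 y * C x2 y * C x3 y * C x4 y) *
      (a i y x1 * a i y x2 * a i y x3 * a i y x4) <=
   (b x1 * b x2 * b x3 * b x4) * ((e i x1 x2)%:R * (e i x3 x4)%:R +
    (e i x1 x3)%:R * (e i x2 x4)%:R + (e i x1 x4)%:R * (e i x2 x3)%:R) * N.
  apply: (@le_trans _ _
     ((b x1 * b x2 * b x3 * b x4) * (paired (e i) x1 x2 x3 x4)%:R * N)).
    have [hp|np] := boolP (paired (e i) x1 x2 x3 x4); last first.
      rewrite (lv_four L) // ?mulr0 ?mul0r // => y y' yy.
      by rewrite (hC x1 _ _ yy) (hC x2 _ _ yy) (hC x3 _ _ yy) (hC x4 _ _ yy).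
    apply: le_trans (ler_norm _) _; apply: le_trans (ler_norm_sum _ _ _) _.
    rewrite mulr1 mulr_natr -sumr_const; apply: ler_sum => y _.
    rewrite !normrM !norm_sign !mulr1.
    by rewrite !ler_pM ?mulr_ge0.
  by rewrite ler_wpM2r ?ler0n // ler_wpM2l ?mulr_ge0 // paired_le.
apply: (@le_trans _ _ (\sum_x1 \sum_x2 \sum_x3 \sum_x4 
   (b x1 * b x2 * b x3 * b x4) * ((e i x1 x2)%:R * (e i x3 x4)%:R +
    (e i x1 x3)%:R * (e i x2 x4)%:R + (e i x1 x4)%:R * (e i x2 x3)%:R) * N)).
  by do 4 apply: ler_sum => ? _.
have E1 : \sum_x1 \sum_x2 \sum_x3 \sum_x4 (b x1 * b x2 * b x3 * b x4) *
    ((e i x1 x2)%:R * (e i x3 x4)%:R) = collision i b ^+ 2.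
  rewrite expr2 {1}/collision mulr_suml; apply: eq_bigr => x1 _.
  rewrite mulr_suml; apply: eq_bigr => x2 _.
  rewrite mulr_sumr; apply: eq_bigr => x3 _.
  by rewrite mulr_sumr; apply: eq_bigr => x4 _; ring.
have E2 : \sum_x1 \sum_x2 \sum_x3 \sum_x4 (b x1 * b x2 * b x3 * b x4) *
    ((e i x1 x3)%:R * (e i x2 x4)%:R) = collision i b ^+ 2.
  rewrite -E1; apply: eq_bigr => x1 _.
  rewrite exchange_big; apply: eq_bigr => x3 _; apply: eq_bigr => x2 _.
  by apply: eq_bigr => x4 _; ring.
have E3 : \sum_x1 \sum_x2 \sum_x3 \sum_x4 (b x1 * b x2 * b x3 * b x4) *
    ((e i x1 x4)%:R * (e i x2 x3)%:R) = collision i b ^+ 2.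
  rewrite -E2; apply: eq_bigr => x1 _; apply: eq_bigr => x2 _.
  rewrite exchange_big; apply: eq_bigr => x4 _.
  by apply: eq_bigr => x3 _; ring.
suff -> : \sum_x1 \sum_x2 \sum_x3 \sum_x4 
   (b x1 * b x2 * b x3 * b x4) * ((e i x1 x2)%:R * (e i x3 x4)%:R +
    (e i x1 x3)%:R * (e i x2 x4)%:R + (e i x1 x4)%:R * (e i x2 x3)%:R) * N =
   (collision i b ^+ 2 + collision i b ^+ 2 + collision i b ^+ 2) * N.
  by rewrite ler_wpM2r ?ler0n //; lra.
rewrite -{1}E1 -{1}E2 -{1}E3 -!big_split mulr_suml; apply: eq_bigr => x1 _ /=.
rewrite -!big_split mulr_suml; apply: eq_bigr => x2 _ /=.
rewrite -!big_split mulr_suml; apply: eq_bigr => x3 _ /=.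
rewrite -!big_split mulr_suml; apply: eq_bigr => x4 _ /=.
by ring.
Qed.

End Walk.

Arguments walk : simpl never.

(** Conditional Jensen inequality: [f] plays the role of the conditional expectation of [f + f'],
    and the sign of [f] is an admissible [psi]. *)
Lemma norm_sum_condexp (R : realFieldType) (V : finType) (r : rel V)
    (f f' : V -> R) : inv r f ->
  (forall psi : V -> R, inv r psi -> \sum_y psi y * f' y = 0) ->
  \sum_y `|f y| <= \sum_y `|f y + f' y|.
Proof.
move=> hf hf'.
pose psi y : R := Num.sg (f y).
have psi_inv : inv r psi by move=> y y' /hf; rewrite /psi => ->.
have -> : \sum_y `|f y| = \sum_y psi y * (f y + f' y).
  under [RHS]eq_bigr => y _ do rewrite mulrDr.
  rewrite big_split /= hf' // addr0; apply: eq_bigr => y _.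
  by rewrite /psi normrEsg.
apply: ler_sum => y _; apply: le_trans (ler_norm _) _.
rewrite normrM /psi normr_sg; case: (f y != 0); first by rewrite mul1r.
by rewrite mul0r normr_ge0.
Qed.

(** * Weighted sums of walks as martingales in y *)

Section Increments.
Variables (R : realFieldType) (V : finType).
Variables (e : nat -> rel V) (a : nat -> V -> V -> R) (s K : nat).
Hypothesis L : level_ok e a s.
Implicit Types (x y : V) (i j n : nat) (c C : V -> V -> R) (b psi u : V -> R).

Local Notation N := (#|V|%:R : R).
Local Notation walk := (walk a K).
Local Notation live := (live a K).
Local Notation step := (step a).
Local Notation collision := (collision e).

(** The weights may depend on y, as they do for the test function of a concentrated part; the
    martingale arguments need them constant in y on parts of level i. *)
Definition inc c i y := \sum_x c x y * (live i x y * step i x y).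

Definition mart c j n y := \sum_x c x y * (walk n x y - walk j x y).

Lemma incE c i y :
  inc c i y = \sum_x (c x y * live i x y * a i x y) * a i y x.
Proof. by apply: eq_bigr => x _; rewrite /step !mulrA. Qed.

Lemma coef_inv c i : (i < s)%N -> (forall x, inv (e i) (c x)) ->
  forall x, inv (e i) (fun y => c x y * live i x y * a i x y).
Proof.
move=> si hc x y y' yy; rewrite (hc x _ _ yy).
rewrite (live_inv K L (ltnW si) (lv_refl L i x) yy).
by rewrite (lv_inv L si (lv_refl L _ x) yy).
Qed.

Lemma inc_mean c i psi : (i < s)%N -> (forall x, inv (e i) (c x)) ->
  inv (e i) psi -> \sum_y psi y * inc c i y = 0.
Proof.
move=> si hc hpsi.
under eq_bigr => y _ do rewrite incE mulr_sumr.
rewrite exchange_big big1 // => x _ /=.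
under eq_bigr => y _ do rewrite mulrA.
apply: (lv_mean L) => // y y' yy.
by rewrite (hpsi _ _ yy) (coef_inv si hc x yy).
Qed.

Lemma coef_le c i b x y : (forall x y, `|c x y| <= b x) ->
  `|c x y * live i x y * a i x y| <= b x.
Proof.
move=> cb; rewrite !normrM (norm_sign L) mulr1.
rewrite -[leRHS]mulr1 ler_pM // ger0_norm ?live_ge0 //; exact: live_le1.
Qed.

Lemma inc2 c i b psi : (i < s)%N -> (forall x, inv (e i) (c x)) ->
  (forall x y, `|c x y| <= b x) -> inv (e i) psi -> (forall y, 0 <= psi y) ->
  \sum_y psi y * inc c i y ^+ 2 <= collision i b * \sum_y psi y.
Proof.
move=> si hc cb hpsi psi0.
under eq_bigr => y _ do rewrite incE.
rewrite (moment2 L si (coef_inv si hc) hpsi) mulr_sumr.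
apply: ler_sum => y _; rewrite mulrC ler_wpM2r //.
apply: ler_sum => x _; apply: ler_sum => x' _; rewrite ler_wpM2r //.
apply: le_trans (ler_norm _) _.
by rewrite normrM ler_pM // coef_le.
Qed.

Lemma inc4 c i b : (i < s)%N -> (forall x, inv (e i) (c x)) ->
  (forall x y, `|c x y| <= b x) ->
  \sum_y inc c i y ^+ 4 <= 3 * collision i b ^+ 2 * N.
Proof.
move=> si hc cb.
under eq_bigr => y _ do rewrite incE.
by apply: (moment4 L si (coef_inv si hc)) => x y; exact: coef_le.
Qed.

Lemma mart0 c j y : mart c j j y = 0.
Proof. by rewrite /mart big1 // => x _; rewrite subrr mulr0. Qed.

Lemma martS c j n y : mart c j n.+1 y = mart c j n y + inc c n y.
Proof.
rewrite /mart /inc -big_split; apply: eq_bigr => x _ /=.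
by rewrite walkS; ring.
Qed.

Lemma mart_inv c j n : (j <= n)%N -> (n <= s)%N ->
  (forall x, inv (e j) (c x)) -> inv (e n) (mart c j n).
Proof.
move=> jn ns hc y y' yy; apply: eq_bigr => x _.
have yyj := same_part_le L jn ns yy.
rewrite (hc x _ _ yyj) (walk_inv K L ns (lv_refl L _ x) yy).
by rewrite (walk_inv K L (leq_trans jn ns) (lv_refl L _ x) yyj).
Qed.

Lemma mart_mean c j n psi : (j <= n)%N -> (n <= s)%N ->
  (forall x, inv (e j) (c x)) -> inv (e j) psi ->
  \sum_y psi y * mart c j n y = 0.
Proof.
move=> /subnKC <-; elim: (n - j)%N => [|d IH].
  by rewrite addn0 => *; rewrite big1 // => y _; rewrite mart0 mulr0.
rewrite addnS => ns hc hpsi.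
under eq_bigr => y _ do rewrite martS mulrDr.
rewrite big_split /= IH ?(ltnW ns) // add0r inc_mean //.
  by move=> x; apply: (inv_le L) (hc x); rewrite ?leq_addr ?(ltnW ns).
by apply: (inv_le L) hpsi; rewrite ?leq_addr ?(ltnW ns).
Qed.

Lemma mart2E c j n : (j <= n)%N -> (n <= s)%N ->
  (forall x, inv (e j) (c x)) ->
  \sum_y mart c j n y ^+ 2 = \sum_(j <= i < n) \sum_y inc c i y ^+ 2.
Proof.
move=> /subnKC <-; elim: (n - j)%N => [|d IH].
  rewrite addn0 => *; rewrite big_geq // big1 // => y _.
  by rewrite mart0 expr0n.
rewrite addnS => ns hc.
rewrite big_nat_recr ?leq_addr //= -IH ?(ltnW ns) //.
have cross : \sum_y (2 * mart c j (j + d) y) * inc c (j + d) y = 0.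
  apply: inc_mean => //.
    by move=> x; apply: (inv_le L) (hc x); rewrite ?leq_addr ?(ltnW ns).
  by move=> y y' yy; rewrite (mart_inv (leq_addr _ _) (ltnW ns) hc yy).
transitivity (\sum_y mart c j (j + d) y ^+ 2 +
  \sum_y (2 * mart c j (j + d) y) * inc c (j + d) y +
  \sum_y inc c (j + d) y ^+ 2); last by rewrite cross addr0.
by rewrite -!big_split; apply: eq_bigr => y _ /=; rewrite martS; ring.
Qed.

Lemma mart2 c j n b : (j <= n)%N -> (n <= s)%N ->
  (forall x, inv (e j) (c x)) -> (forall x y, `|c x y| <= b x) ->
  \sum_y mart c j n y ^+ 2 <= (\sum_(j <= i < n) collision i b) * N.
Proof.
move=> jn ns hc cb; rewrite mart2E // mulr_suml.
rewrite !big_seq; apply: ler_sum => i; rewrite mem_index_iota => /andP[ji i_n].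
have iN := leq_trans i_n ns.
have hci x : inv (e i) (c x) by apply: (inv_le L ji (ltnW iN)).
have := inc2 iN hci cb (psi := fun=> 1) (fun _ _ _ => erefl) (fun=> ler01).
rewrite sumr_const => h; apply: le_trans h; apply: ler_sum => y _.
by rewrite mul1r.
Qed.

Lemma mart4 c j n b : (j <= n)%N -> (n <= s)%N ->
  (forall x, inv (e j) (c x)) -> (forall x y, `|c x y| <= b x) ->
  \sum_y mart c j n y ^+ 4 <= 9 * (\sum_(j <= i < n) collision i b) ^+ 2 * N.
Proof.
move=> /subnKC <-; elim: (n - j)%N => [|d IH].
  rewrite addn0 => *; rewrite big_geq // expr0n /= mulr0 mul0r big1 // => y _.
  by rewrite mart0 expr0n.
rewrite addnS => ns hc cb.
have b0 x : 0 <= b x by apply: le_trans (cb x x).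
rewrite big_nat_recr ?leq_addr //=.
have := IH (ltnW ns) hc cb; have := mart2 (leq_addr d j) (ltnW ns) hc cb.
set M := \sum_(j <= i < j + d) collision i b.
have hci x : inv (e (j + d)) (c x).
  by apply: (inv_le L) (hc x); rewrite ?leq_addr ?(ltnW ns).
have mi := mart_inv (leq_addr d j) (ltnW ns) hc.
set H := mart c j (j + d); set h := inc c (j + d); set v := collision _ b.
have v0 : 0 <= v by apply: collision_ge0.
have M0 : 0 <= M by apply: sumr_ge0 => i _; apply: collision_ge0.
move=> H2 H4.
have c1 : \sum_y H y ^+ 3 * h y = 0.
  by apply: inc_mean => // y y' yy; rewrite /H (mi _ _ yy).
have c2 : \sum_y H y ^+ 2 * h y ^+ 2 <= v * \sum_y H y ^+ 2.
  apply: inc2 => //; first by move=> y y' yy; rewrite /H (mi _ _ yy).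
  by move=> y; rewrite sqr_ge0.
have c4 : \sum_y h y ^+ 4 <= 3 * v ^+ 2 * N by apply: inc4.
(* The odd term 4 H h^3 is at most 2 H^2 h^2 + 2 h^4. *)
apply: (@le_trans _ _ (\sum_y H y ^+ 4 + 4 * (\sum_y H y ^+ 3 * h y) +
  8 * (\sum_y H y ^+ 2 * h y ^+ 2) + 3 * \sum_y h y ^+ 4)).
  rewrite !mulr_sumr -!big_split /=; apply: ler_sum => y _.
  rewrite martS -/H -/h; move: (H y) (h y) => z w.
  have -> : z ^+ 4 + 4 * (z ^+ 3 * w) + 8 * (z ^+ 2 * w ^+ 2) + 3 * w ^+ 4 =
    (z + w) ^+ 4 + 2 * (w ^+ 2 * (z - w) ^+ 2) by ring.
  by rewrite lerDl mulr_ge0 // mulr_ge0 ?sqr_ge0.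
rewrite c1 mulr0 addr0.
have : v * \sum_y H y ^+ 2 <= v * (M * N) by rewrite ler_wpM2l.
have N0 : 0 <= N by rewrite ler0n.
have := mulr_ge0 (mulr_ge0 v0 M0) N0.
have := mulr_ge0 (mulr_ge0 v0 v0) N0.
move: (\sum_y H y ^+ 4) (\sum_y H y ^+ 2 * h y ^+ 2) (\sum_y h y ^+ 4)
  (\sum_y H y ^+ 2) H2 H4 c2 c4 => X4 X22 Y4 X2 H2 H4 c2 c4 h1 h2 h3.
have -> : 9 * (M + v) ^+ 2 * N = 9 * M ^+ 2 * N + 18 * (v * M * N) +
  9 * (v * v * N) by ring.
have e1 : v * (M * N) = v * M * N by ring.
have e2 : 3 * v ^+ 2 * N = 3 * (v * v * N) by ring.
by rewrite e1 in h3; rewrite e2 in c4; lra.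
Qed.

Lemma norm_sum_walk_le u j : (j <= s)%N ->
  \sum_y `|\sum_x u x * walk j x y| <= \sum_y `|\sum_x u x * walk s x y|.
Proof.
move=> js.
have -> : \sum_y `|\sum_x u x * walk s x y| =
    \sum_y `|\sum_x u x * walk j x y + mart (fun x _ => u x) j s y|.
  apply: eq_bigr => y _; rewrite /mart -big_split; congr `|_|.
  by apply: eq_bigr => x _ /=; ring.
apply: (norm_sum_condexp (r := e j)).
  move=> y y' yy; apply: eq_bigr => x _.
  by rewrite (walk_inv K L js (lv_refl L _ x) yy).
by move=> psi hpsi; apply: mart_mean.
Qed.

(** A difference of two conditional expectations, each of which contracts the L1 norm; hence the
    factor 2. *)
Lemma norm_sum_mart_le u j n : (j <= n)%N -> (n <= s)%N ->
  \sum_y `|mart (fun x _ => u x) j n y| <=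
  2 * \sum_y `|\sum_x u x * walk s x y|.
Proof.
move=> jn ns.
have hj := norm_sum_walk_le u (leq_trans jn ns).
have hn := norm_sum_walk_le u ns.
apply: (@le_trans _ _ (\sum_y `|\sum_x u x * walk n x y| +
  \sum_y `|\sum_x u x * walk j x y|)); last by lra.
rewrite -big_split; apply: ler_sum => y _ /=.
have -> : mart (fun x _ => u x) j n y =
    \sum_x u x * walk n x y - \sum_x u x * walk j x y.
  by rewrite /mart -sumrB; apply: eq_bigr => x _; rewrite mulrBr.
exact: ler_normB.
Qed.

End Increments.

(** * Test functions for a single part *)

(* Turns bounds on second and fourth moments into a bound on the L1 norm. *)
Lemma norm_ge_moments (R : realFieldType) (l z : R) : 0 <= l ->
  l * z ^+ 2 - l ^+ 3 * z ^+ 4 <= `|z|.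
Proof.
move=> l0; rewrite -(real_normK (num_real z)).
have -> : z ^+ 4 = `|z| ^+ 4.
  by rewrite -[4%N]/(2 * 2)%N !exprM (real_normK (num_real z)).
move: (`|z|) (normr_ge0 z) => {}z z0.
have lz0 : 0 <= l * z by apply: mulr_ge0.
have -> : l * z ^+ 2 - l ^+ 3 * z ^+ 4 =
  z * (l * z - (l * z) ^+ 3) by ring.
rewrite -[leRHS]mulr1 ler_wpM2l //; move: (l * z) lz0 => t t0.
have [t1|t1] := lerP t 1; first by have := exprn_ge0 3 t0; lra.
have : t <= t ^+ 3 by rewrite -{1}(expr1 t) ler_weXn2l // ltW.
by lra.
Qed.

Lemma exists_ge_mean (R : realFieldType) (V : finType) (f : V -> R) (m : R) :
  (0 < #|V|)%N -> m * #|V|%:R <= \sum_y f y -> exists y, m <= f y.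
Proof.
move=> V0 h; apply/existsP; apply: contraT => /existsPn hn.
have [y0 _] : exists y0 : V, y0 \in V by apply/card_gt0P.
suff : \sum_y f y < \sum_(y : V) m by rewrite sumr_const -mulr_natr ltNge h.
apply: ltr_sum => [|y _]; last by rewrite ltNge hn.
by apply/hasP; exists y0; rewrite // mem_index_enum.
Qed.

(** * Correlations of the increments of one level *)

Section Kernel.
Variables (R : rcfType) (V : finType).
Variables (e : nat -> rel V) (a : nat -> V -> V -> R) (s K : nat).
Hypothesis L : level_ok e a s.
Hypothesis K0 : (0 < K)%N.
Hypothesis slow : (s%:R / K%:R ^+ 2 : R) <= 1 / 100.
Implicit Types (x y : V) (i j n : nat) (c C : V -> V -> R) (b psi u : V -> R).

Local Notation N := (#|V|%:R : R).
Local Notation walk := (walk a K).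
Local Notation live := (live a K).
Local Notation step := (step a).
Local Notation collision := (collision e).
Local Notation F i x y := (live i x y * step i x y).

(** A Gram matrix, hence positive semidefinite. It is nearly #|V| inside parts of level i + 1, small
    between two of them, and 0 between parts of level i. *)
Definition kern i x x' := \sum_y F i x y * F i x' y.

Lemma kern_off i x x' : (i < s)%N -> ~~ e i x x' -> kern i x x' = 0.
Proof.
move=> si nxx.
have h z y y' : e i y y' -> live i z y * a i z y = live i z y' * a i z y'.
  move=> yy; rewrite (live_inv K L (ltnW si) (lv_refl L i z) yy).
  by rewrite (lv_inv L si (lv_refl L _ z) yy).
rewrite -[RHS](lv_pair L (psi := fun y => live i x y * a i x y *
  (live i x' y * a i x' y)) si _ nxx).
  by apply: eq_bigr => y _; rewrite /step; ring.
by move=> y y' yy; rewrite (h x _ _ yy) (h x' _ _ yy).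
Qed.

Lemma kern_in i x x' : (i < s)%N -> e i x x' ->
  kern i x x' = \sum_y live i x y * (a i x y * a i x' y).
Proof.
move=> si xx; apply: eq_bigr => y _.
rewrite -(live_inv K L (ltnW si) xx (lv_refl L i y)) /step.
have -> : a i y x' = a i y x.
  by apply: (lv_inv L) => //; rewrite ?(lv_refl L) // (lv_sym L).
transitivity ((live i x y * live i x y) * (a i x y * a i x' y) *
  (a i y x * a i y x)); first by ring.
by rewrite live_sq (lv_sq L) mulr1.
Qed.

Lemma kern_same i x x' : (i < s)%N -> e i.+1 x x' ->
  kern i x x' = \sum_y live i x y.
Proof.
move=> si xx; rewrite (kern_in si (lv_sub L si xx)); apply: eq_bigr => y _.
rewrite (lv_inv L si xx (lv_refl L i y)) (lv_sq L) mulr1 //.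
Qed.

Lemma sum_live_ge i x : (i <= s)%N -> 99 / 100 * N <= \sum_y live i x y.
Proof.
move=> si; have := sum_stopped L K0 x si.
have -> : \sum_y (1 - live i x y) = N - \sum_y live i x y.
  by rewrite sumrB sumr_const.
move=> h.
have h' : s%:R / K%:R ^+ 2 * N <= 1 / 100 * N by rewrite ler_wpM2r ?ler0n.
by have := le_trans h h'; clear h h'; lra.
Qed.

(** A quarter comes from [lv_row] and 1/100 from the stopped pairs. *)
Lemma kern_diff i x x' : (i < s)%N -> e i x x' -> ~~ e i.+1 x x' ->
  `|kern i x x'| <= 26 / 100 * N.
Proof.
move=> si xx nxx; rewrite kern_in //.
have hr := lv_row L si xx nxx.
have hs := sum_stopped L K0 x (ltnW si).
have h' : s%:R / K%:R ^+ 2 * N <= 1 / 100 * N by rewrite ler_wpM2r ?ler0n.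
have -> : \sum_y live i x y * (a i x y * a i x' y) =
   \sum_y a i x y * a i x' y - \sum_y (1 - live i x y) * (a i x y * a i x' y).
  by rewrite -sumrB; apply: eq_bigr => y _; ring.
have h2 : `|\sum_y (1 - live i x y) * (a i x y * a i x' y)| <=
    \sum_y (1 - live i x y).
  apply: le_trans (ler_norm_sum _ _ _) _; apply: ler_sum => y _.
  rewrite !normrM !(norm_sign L) !mulr1 ger0_norm // subr_ge0; exact: live_le1.
by apply: le_trans (ler_normB _ _) _; lra.
Qed.

Lemma kern_ge i x x' : (i < s)%N ->
  (125 / 100 * (e i.+1 x x')%:R - 26 / 100 * (e i x x')%:R) * N <=
  kern i x x'.
Proof.
move=> si; have [xx|nxx] := boolP (e i x x'); last first.
  rewrite kern_off //; have /negbTE -> : ~~ e i.+1 x x'.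
    by apply: contra nxx; apply: (lv_sub L).
  by rewrite !mulr0 subr0 mul0r.
have [xx'|nxx'] := boolP (e i.+1 x x').
  by rewrite kern_same //=; have := sum_live_ge x (ltnW si); lra.
by have := kern_diff si xx nxx'; rewrite ler_norml /=; lra.
Qed.

Section Weighted.
Variable mu : V -> R.
Hypothesis mu_ge0 : forall x, 0 <= mu x.
Hypothesis mu_sum : \sum_x mu x = 1.

Definition cell i x := \sum_x' mu x' * (e i x x')%:R.

Lemma cell_ge0 i x : 0 <= cell i x.
Proof. by apply: sumr_ge0 => z _; rewrite mulr_ge0. Qed.

Lemma collision_cell i : collision i mu = \sum_x mu x * cell i x.
Proof.
apply: eq_bigr => x _; rewrite mulr_sumr; apply: eq_bigr => x' _.
by rewrite mulrA.
Qed.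

Lemma collision_le1 i : collision i mu <= 1.
Proof.
rewrite collision_cell -[leRHS]mu_sum; apply: ler_sum => x _.
rewrite -[leRHS]mulr1 ler_wpM2l // -mu_sum; apply: ler_sum => z _.
by rewrite -[leRHS]mulr1 ler_wpM2l //; case: (e i x z).
Qed.

Lemma cell_inv i x x' : e i x x' -> cell i x = cell i x'.
Proof.
move=> xx; apply: eq_bigr => z _; congr (_ * _%:R); congr nat_of_bool.
apply/idP/idP; apply: (lv_trans L) => //.
by rewrite (lv_sym L).
Qed.

Lemma cell2_le_collision i x : cell i x ^+ 2 <= collision i mu.
Proof.
rewrite collision_cell expr2 {1}/cell mulr_suml; apply: ler_sum => z _.
rewrite -mulrA ler_wpM2l //.
have [xz|_] := boolP (e i x z); last by rewrite mul0r cell_ge0.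
by rewrite mul1r (cell_inv xz).
Qed.

Definition meanF i y := \sum_x mu x * F i x y.

Lemma sum_meanF2 i : \sum_y meanF i y ^+ 2 =
  \sum_x \sum_x' mu x * mu x' * kern i x x'.
Proof.
under [RHS]eq_bigr => x _ do
  (under eq_bigr => x' _ do rewrite mulr_sumr; rewrite exchange_big).
rewrite [RHS]exchange_big; apply: eq_bigr => y _ /=.
rewrite expr2 big_distrlr; apply: eq_bigr => x _; apply: eq_bigr => x' _ /=.
by ring.
Qed.

(** The weaker coefficients 1 and 1/2 are chosen so that summing over the levels leaves half of the
    collision probabilities ([tail_recr]). *)
Lemma sum_kern_ge i : (i < s)%N ->
  (collision i.+1 mu - 1 / 2 * collision i mu) * N <=
  \sum_x \sum_x' mu x * mu x' * kern i x x'.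
Proof.
move=> si.
apply: (@le_trans _ _ ((125 / 100 * collision i.+1 mu -
  26 / 100 * collision i mu) * N)).
  rewrite ler_wpM2r ?ler0n //.
  have := collision_ge0 e i mu_ge0; have := collision_ge0 e i.+1 mu_ge0; lra.
have -> : (125 / 100 * collision i.+1 mu - 26 / 100 * collision i mu) * N =
  \sum_x \sum_x' mu x * mu x' *
    ((125 / 100 * (e i.+1 x x')%:R - 26 / 100 * (e i x x')%:R) * N).
  rewrite /collision !mulr_sumr -sumrB mulr_suml; apply: eq_bigr => x _.
  rewrite !mulr_sumr -sumrB mulr_suml; apply: eq_bigr => x' _.
  by ring.
do 2 apply: ler_sum => ? _; rewrite ler_wpM2l ?mulr_ge0 //.
exact: kern_ge.
Qed.

(* The mean over random signs, constant on parts of level j + 1, of the squared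
   level-i contribution of the centred signs. *)
Definition spread_form j i y :=
  \sum_x \sum_x' (mu x * (F i x y - meanF i y)) *
    (mu x' * (F i x' y - meanF i y)) * (e j.+1 x x')%:R.

(** At level j itself [F j x y] sees only the part of x in level j + 1, so the form is a weighted
    sum of squared deviations from the mean. These are large because no such part carries more than
    3/4 of the mass. *)
Lemma spread_form_first j : (j < s)%N -> (forall x, cell j.+1 x <= 3 / 4) ->
  1 / 64 * collision j.+1 mu * N <= \sum_y spread_form j j y.
Proof.
move=> js hw.
have F_inv x x' y : e j.+1 x x' -> F j x y = F j x' y.
  move=> xx; have xx0 := lv_sub L js xx.
  rewrite (live_inv K L (ltnW js) xx0 (lv_refl L j y)) /step.
  rewrite (lv_inv L js xx (lv_refl L j y)).
  by rewrite (lv_inv L js (lv_refl L _ y) xx0).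
have -> : \sum_y spread_form j j y =
    \sum_x mu x * cell j.+1 x * \sum_y (F j x y - meanF j y) ^+ 2.
  under [RHS]eq_bigr => x _ do rewrite mulr_sumr.
  rewrite [RHS]exchange_big; apply: eq_bigr => y _; apply: eq_bigr => x _ /=.
  rewrite /cell mulr_sumr mulr_suml; apply: eq_bigr => x' _.
  have [xx|_] := boolP (e j.+1 x x'); last by rewrite !mulr0 mul0r.
  have xx' : e j.+1 x' x by rewrite (lv_sym L).
  by rewrite (F_inv x' x y xx') /=; ring.
rewrite collision_cell mulr_sumr mulr_suml; apply: ler_sum => x _.
have -> : 1 / 64 * (mu x * cell j.+1 x) * N =
  mu x * cell j.+1 x * (1 / 64 * N) by ring.
rewrite ler_wpM2l ?mulr_ge0 ?cell_ge0 //.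
have F2 y : F j x y ^+ 2 <= 1.
  have -> : F j x y ^+ 2 =
    (live j x y * live j x y) * (a j x y * a j x y) * (a j y x * a j y x).
    by rewrite /step; ring.
  by rewrite !(lv_sq L) !mulr1 live_sq; exact: live_le1.
(* The inequality (f - m)^2 >= f (f - m) / 4 - f^2 / 64 replaces the square by a correlation, which
   the kernel computes. *)
apply: (@le_trans _ _ (\sum_y (1 / 4 * (F j x y * (F j x y - meanF j y)) -
   1 / 64))); last first.
  apply: ler_sum => y _; move: (F2 y).
  move: (F j x y) (meanF j y) => f m f2.
  by have := sqr_ge0 (f - m - f / 8); nra.
rewrite sumrB sumr_const -mulr_sumr.
suff : 1 / 8 * N <= \sum_y F j x y * (F j x y - meanF j y).
  by rewrite -[1 / 64 *+ _]mulr_natr; lra.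
have -> : \sum_y F j x y * (F j x y - meanF j y) =
    \sum_x' mu x' * (kern j x x - kern j x x').
  under [RHS]eq_bigr => x' _ do rewrite mulrBr.
  rewrite sumrB -mulr_suml mu_sum mul1r.
  under [X in _ = _ - X]eq_bigr => x' _ do rewrite /kern mulr_sumr.
  rewrite [X in _ = _ - X]exchange_big /= -sumrB; apply: eq_bigr => y _.
  rewrite mulrBr; congr (_ - _); rewrite /meanF mulr_sumr.
  by apply: eq_bigr => x' _; ring.
apply: (@le_trans _ _ (\sum_x' mu x' * ((1 - (e j.+1 x x')%:R) * (73 / 100 * N)))).
  have -> : \sum_x' mu x' * ((1 - (e j.+1 x x')%:R) * (73 / 100 * N)) =
      (1 - cell j.+1 x) * (73 / 100 * N).
    have -> : 1 - cell j.+1 x = \sum_x' (mu x' - mu x' * (e j.+1 x x')%:R).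
      by rewrite sumrB mu_sum.
    by rewrite mulr_suml; apply: eq_bigr => x' _; ring.
  have := hw x; have : 0 <= N by rewrite ler0n.
  by move: (cell _ _) N => w n; nra.
apply: ler_sum => x' _; rewrite ler_wpM2l //.
rewrite (kern_same js (lv_refl L _ x)).
have hl := sum_live_ge x (ltnW js).
have N0 : 0 <= N by rewrite ler0n.
have [xx|nxx] := boolP (e j x x'); last first.
  rewrite kern_off //; have /negbTE -> : ~~ e j.+1 x x'.
    by apply: contra nxx; apply: (lv_sub L).
  by rewrite /=; lra.
have [xx'|nxx'] := boolP (e j.+1 x x').
  by rewrite (kern_same js xx') /=; lra.
by have := kern_diff js xx nxx'; rewrite ler_norml /=; lra.
Qed.

(** Beyond level j the kernel vanishes between parts of level j + 1, so centring amounts to the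
    weight 1 - 2w + p with w = [cell j.+1 x]. As p >= w^2 and w <= 3/4, it is at least (1 - w)^2 >=
    1/16, and by semidefiniteness it may be replaced by 1/16. *)
Lemma spread_form_later j i : (j < i)%N -> (i < s)%N ->
  (forall x, cell j.+1 x <= 3 / 4) ->
  1 / 64 * (collision i.+1 mu - 1 / 2 * collision i mu) * N <=
  \sum_y spread_form j i y.
Proof.
move=> ji is_ hw.
set p := collision j.+1 mu.
have js := ltn_trans ji is_.
have kern0 x x' : ~~ e j.+1 x x' -> kern i x x' = 0.
  move=> h; apply: kern_off => //; apply: contra h.
  by apply: (same_part_le L); rewrite // ltnW.
have -> : \sum_y spread_form j i y =
    \sum_x \sum_x' mu x * mu x' * (1 - 2 * cell j.+1 x + p) * kern i x x'.
  have E1 : \sum_y \sum_x \sum_x' mu x * mu x' * (e j.+1 x x')%:R *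
      (F i x y * F i x' y) = \sum_x \sum_x' mu x * mu x' * kern i x x'.
    rewrite exchange_big; apply: eq_bigr => x _.
    rewrite exchange_big; apply: eq_bigr => x' _ /=.
    rewrite -mulr_sumr -/(kern i x x').
    have [//|/kern0 ->] := boolP (e j.+1 x x'); first by rewrite mulr1.
    by rewrite !mulr0.
  have E2 : \sum_y (\sum_x mu x * cell j.+1 x * F i x y) * meanF i y =
      \sum_x \sum_x' mu x * mu x' * cell j.+1 x * kern i x x'.
    under [RHS]eq_bigr => x _ do
      (under eq_bigr => x' _ do rewrite mulr_sumr; rewrite exchange_big).
    rewrite [RHS]exchange_big; apply: eq_bigr => y _ /=.
    rewrite big_distrlr; apply: eq_bigr => x _; apply: eq_bigr => x' _ /=.
    by ring.
  have E3 y : spread_form j i y =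
      \sum_x \sum_x' mu x * mu x' * (e j.+1 x x')%:R * (F i x y * F i x' y) -
      2 * ((\sum_x mu x * cell j.+1 x * F i x y) * meanF i y) +
      p * meanF i y ^+ 2.
    have D1 : \sum_x mu x * cell j.+1 x * F i x y =
        \sum_x \sum_x' mu x * mu x' * (e j.+1 x x')%:R * F i x y.
      apply: eq_bigr => x _; rewrite /cell mulr_sumr mulr_suml.
      by apply: eq_bigr => x' _; ring.
    have D2 : \sum_x mu x * cell j.+1 x * F i x y =
        \sum_x \sum_x' mu x * mu x' * (e j.+1 x x')%:R * F i x' y.
      rewrite D1 exchange_big; apply: eq_bigr => x _; apply: eq_bigr => x' _.
      by rewrite (lv_sym L); ring.
    rewrite mulr_natl mulr2n {1}D1 D2 /p /collision !mulr_suml.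
    rewrite opprD addrA -!sumrB -big_split; apply: eq_bigr => x _ /=.
    rewrite !mulr_suml -!sumrB -big_split; apply: eq_bigr => x' _ /=.
    by ring.
  rewrite (eq_bigr _ (fun y _ => E3 y)) big_split sumrB /= E1 -!mulr_sumr.
  rewrite E2 sum_meanF2; move: (cell j.+1) => w.
  rewrite !mulr_sumr -sumrB -big_split; apply: eq_bigr => x _ /=.
  rewrite !mulr_sumr -sumrB -big_split; apply: eq_bigr => x' _ /=.
  by ring.
(* The root of the excess over 1/16 is constant on parts of level j + 1, so it can be shared between
   the two arguments of the kernel. *)
set sig := fun x => Num.sqrt (1 - 2 * cell j.+1 x + p - 1 / 16).
have sig2 x : sig x ^+ 2 = 1 - 2 * cell j.+1 x + p - 1 / 16.
  rewrite sqr_sqrtr //; have := hw x; have := cell2_le_collision j.+1 x.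
  by rewrite -/p; move: (cell _ _) => w; nra.
have sum_sig : 0 <= \sum_x \sum_x' mu x * mu x' * sig x ^+ 2 * kern i x x'.
  have -> : \sum_x \sum_x' mu x * mu x' * sig x ^+ 2 * kern i x x' =
      \sum_y (\sum_x mu x * sig x * F i x y) ^+ 2.
    transitivity (\sum_x \sum_x' mu x * mu x' * (sig x * sig x') * kern i x x').
      apply: eq_bigr => x _; apply: eq_bigr => x' _.
      have [xx|/kern0 ->] := boolP (e j.+1 x x'); last by rewrite !mulr0.
      by rewrite {3}/sig -(cell_inv xx) -/(sig x) expr2.
    under eq_bigr => x _ do
      (under eq_bigr => x' _ do rewrite mulr_sumr; rewrite exchange_big).
    rewrite exchange_big; apply: eq_bigr => y _ /=.
    rewrite expr2 big_distrlr; apply: eq_bigr => x _; apply: eq_bigr => x' _ /=.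
    by ring.
  by apply: sumr_ge0 => y _; rewrite sqr_ge0.
have -> : \sum_x \sum_x' mu x * mu x' * (1 - 2 * cell j.+1 x + p) *
      kern i x x' =
    \sum_x \sum_x' mu x * mu x' * sig x ^+ 2 * kern i x x' +
    1 / 16 * \sum_x \sum_x' mu x * mu x' * kern i x x'.
  rewrite [X in _ = _ + X]mulr_sumr -big_split; apply: eq_bigr => x _ /=.
  rewrite [X in _ = _ + X]mulr_sumr -big_split; apply: eq_bigr => x' _ /=.
  by rewrite sig2; ring.
have k0 : 0 <= \sum_x \sum_x' mu x * mu x' * kern i x x'.
  by rewrite -sum_meanF2; apply: sumr_ge0 => y _; rewrite sqr_ge0.
have := sum_kern_ge is_; move: sum_sig k0.
move: (\sum_x \sum_x' _) => A; move: (\sum_x \sum_x' _) => B.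
by rewrite -mulrA; lra.
Qed.

End Weighted.
End Kernel.

(** * Gradual dispersion: signs of a later level as test functions *)

Section Gradual.
Variables (R : rcfType) (V : finType).
Variables (e : nat -> rel V) (a : nat -> V -> V -> R) (s K : nat).
Hypothesis L : level_ok e a s.
Hypothesis K0 : (0 < K)%N.
Hypothesis slow : (s%:R / K%:R ^+ 2 : R) <= 1 / 100.
Variable mu : V -> R.
Hypothesis mu_ge0 : forall x, 0 <= mu x.
Hypothesis mu_sum : \sum_x mu x = 1.
Implicit Types (x y : V) (i j n : nat).

Local Notation N := (#|V|%:R : R).
Local Notation walk := (walk a K).
Local Notation live := (live a K).
Local Notation step := (step a).
Local Notation coll i := (collision e i mu).
Local Notation cell := (cell e mu).
Local Notation inc := (inc a K).
Local Notation mart := (mart a K).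

Definition tail j := \sum_(j.+1 <= i < s.+1) coll i.

(** The vertex [z] is the seed of the random signs. Subtracting the mean makes the test blind to
    constant densities. *)
Definition centred j z x := a j.+1 z x - \sum_x' mu x' * a j.+1 z x'.

Lemma sum_inc_centred2 j i y : (j.+1 < s)%N ->
  \sum_z inc (fun x _ => mu x * centred j z x) i y ^+ 2 =
  N * spread_form e a K mu j i y.
Proof.
move=> js.
have E z : inc (fun x _ => mu x * centred j z x) i y =
    \sum_x (mu x * (live i x y * step i x y - meanF a K mu i y)) * a j.+1 z x.
  rewrite /inc /centred.
  set A := \sum_x' mu x' * a j.+1 z x'.
  transitivity (\sum_x mu x * a j.+1 z x * (live i x y * step i x y) -
     A * meanF a K mu i y).
    by rewrite /meanF mulr_sumr -sumrB; apply: eq_bigr => x _; ring.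
  by rewrite /A mulr_suml -sumrB; apply: eq_bigr => x _; ring.
under eq_bigr => z _ do rewrite E -[_ ^+ 2]mul1r.
rewrite (moment2 L js (C := fun x _ => mu x *
  (live i x y * step i x y - meanF a K mu i y)) (psi := fun=> 1)) //.
by rewrite sumr_const mul1r -[LHS]mulr_natl.
Qed.

Lemma tail_recr j : (j.+1 < s)%N ->
  1 / 2 * tail j <= coll j.+1 +
  \sum_(j.+1 <= i < s) (coll i.+1 - 1 / 2 * coll i).
Proof.
move=> js; rewrite sumrB -mulr_sumr.
have -> : \sum_(j.+1 <= i < s) coll i.+1 = tail j - coll j.+1.
  by rewrite /tail [in RHS]big_ltn ?ltnS ?(ltnW js) // [RHS]addrAC subrr add0r big_add1.
have -> : \sum_(j.+1 <= i < s) coll i = tail j - coll s.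
  by rewrite /tail big_nat_recr ?(ltnW js) //= addrK.
have := collision_ge0 e s mu_ge0; have := collision_ge0 e j.+1 mu_ge0.
by lra.
Qed.

Lemma exists_centred_mart2 j : (0 < #|V|)%N -> (j.+1 < s)%N ->
  (forall x, cell j.+1 x <= 3 / 4) ->
  exists z, 1 / 128 * tail j * N <=
    \sum_y mart (fun x _ => mu x * centred j z x) j s y ^+ 2.
Proof.
move=> V0 js hw; apply: exists_ge_mean => //.
have js0 := ltnW (ltnW js).
under [leRHS]eq_bigr => z _ do rewrite (mart2E K L) //.
rewrite exchange_big /=.
have -> : \sum_(j <= i < s) \sum_z \sum_y
    inc (fun x _ => mu x * centred j z x) i y ^+ 2 =
    N * \sum_(j <= i < s) \sum_y spread_form e a K mu j i y.
  rewrite mulr_sumr; apply: eq_bigr => i _; rewrite exchange_big mulr_sumr.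
  by apply: eq_bigr => y _; rewrite /= sum_inc_centred2.
rewrite mulrC ler_wpM2l ?ler0n // big_ltn ?(ltnW js) //.
have h1 := spread_form_first L K0 slow mu_ge0 mu_sum (ltnW js) hw.
have h2 : 1 / 64 * (\sum_(j.+1 <= i < s)
    (coll i.+1 - 1 / 2 * coll i)) * N <=
    \sum_(j.+1 <= i < s) \sum_y spread_form e a K mu j i y.
  rewrite mulr_sumr mulr_suml [leLHS]big_seq [leRHS]big_seq.
  apply: ler_sum => i; rewrite mem_index_iota => /andP[ji is_].
  exact: (spread_form_later L K0 slow mu_ge0 ji is_ hw).
apply: le_trans (lerD h1 h2).
rewrite -mulrDl -mulrDr ler_wpM2r ?ler0n //.
by have := tail_recr js; lra.
Qed.

(* When [tail] is not small, the test function is a column of signs of level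
   j + 1, centred; it works for a random column, by the fourth moment method. *)
Lemma gradual_test j : (0 < #|V|)%N -> (j.+1 < s)%N ->
  (forall x, cell j.+1 x <= 3 / 4) -> 1 / 200 ^+ 2 <= tail j ->
  exists u : V -> R, [/\ forall x, `|u x| <= 2,
    \sum_x mu x * u x = 0 &
    1 / 10 ^+ 13 * N <= \sum_y `|\sum_x mu x * u x * walk s x y|].
Proof.
move=> V0 js hw hT; have js0 := ltnW (ltnW js).
have [z hz] := exists_centred_mart2 V0 js hw.
have mean_le : `|\sum_x mu x * a j.+1 z x| <= 1.
  apply: le_trans (ler_norm_sum _ _ _) _; rewrite -mu_sum; apply: ler_sum => x _.
  by rewrite normrM (norm_sign L) mulr1 ger0_norm.
have u2 x : `|centred j z x| <= 2.
  by apply: le_trans (ler_normB _ _) _; rewrite (norm_sign L); lra.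
exists (centred j z); split=> //.
  rewrite /centred; set A := \sum_x' mu x' * a j.+1 z x'.
  under eq_bigr => x _ do rewrite mulrBr.
  by rewrite sumrB -mulr_suml mu_sum mul1r subrr.
set c := fun (x _ : V) => mu x * centred j z x in hz.
have cb x y : `|c x y| <= 2 * mu x.
  by rewrite /c normrM (ger0_norm (mu_ge0 x)) mulrC ler_wpM2r.
have h4 := mart4 K L js0 (leqnn s) (c := c) (fun _ _ _ _ => erefl) cb.
have eC i : collision e i (fun x => 2 * mu x) = 4 * coll i.
  rewrite /collision mulr_sumr; apply: eq_bigr => x _.
  by rewrite mulr_sumr; apply: eq_bigr => x' _; ring.
(* Level j contributes at most 1; the later levels are part of [tail j]. *)
have hC : \sum_(j <= i < s) collision e i (fun x => 2 * mu x) <=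
    4 * (1 + tail j).
  rewrite (eq_bigr _ (fun i _ => eC i)) -mulr_sumr ler_wpM2l //.
  rewrite big_ltn ?(ltnW js) // lerD ?collision_le1 //.
  by rewrite /tail big_nat_recr ?(ltnW js) //= lerDl collision_ge0.
have hC0 : 0 <= \sum_(j <= i < s) collision e i (fun x => 2 * mu x).
  by apply: sumr_ge0 => i _; apply: collision_ge0 => x; rewrite mulr_ge0.
have N0 : 0 <= N by rewrite ler0n.
have {}h4 : \sum_y mart c j s y ^+ 4 <= 144 * (1 + tail j) ^+ 2 * N.
  apply: le_trans h4 _; rewrite ler_wpM2r //.
  have -> : 144 * (1 + tail j) ^+ 2 = 9 * (4 * (1 + tail j)) ^+ 2 by ring.
  rewrite ler_wpM2l // lerXn2r ?nnegrE //.
  exact: le_trans hC.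
set T := tail j in hz h4 hT *.
have T1 : 0 < 1 + T by lra.
have T2 : 0 < 50 * 10 ^+ 3 * (1 + T) by lra.
(* With this [l] the fourth moment costs at most half of the second: 144 / (50 * 10^3)^2 <= T / 256
   for T >= 1 / 200^2. *)
set l : R := (50 * 10 ^+ 3 * (1 + T))^-1.
have l0 : 0 < l by rewrite invr_gt0.
have lT : l * (1 + T) = 1 / (50 * 10 ^+ 3).
  by rewrite /l; field; rewrite gt_eqF.
have hL := norm_sum_mart_le K L (fun x => mu x * centred j z x) js0 (leqnn s).
have hm : l * \sum_y mart c j s y ^+ 2 - l ^+ 3 * \sum_y mart c j s y ^+ 4 <=
    \sum_y `|mart c j s y|.
  rewrite !mulr_sumr -sumrB; apply: ler_sum => y _.
  by apply: norm_ge_moments; exact: ltW.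
have h2 : l * (1 / 128 * T * N) <= l * \sum_y mart c j s y ^+ 2.
  by rewrite ler_wpM2l // ltW.
have h3 : l ^+ 3 * \sum_y mart c j s y ^+ 4 <= l * (T / 256 * N).
  apply: (@le_trans _ _ (l ^+ 3 * (144 * (1 + T) ^+ 2 * N))).
    by rewrite ler_wpM2l // exprn_ge0 // ltW.
  have -> : l ^+ 3 * (144 * (1 + T) ^+ 2 * N) =
    l * (144 * (l * (1 + T)) ^+ 2 * N) by ring.
  by rewrite lT ler_wpM2l ?(ltW l0) // ler_wpM2r //; lra.
have h5 : 1 / 200 ^+ 2 / 10 ^+ 5 <= l * T.
  rewrite /l [leRHS]mulrC ler_pdivlMr //.
  by lra.
have h6 : 1 / 200 ^+ 2 / 10 ^+ 5 * N <= l * T * N by rewrite ler_wpM2r.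
have {}hL := le_trans hm hL.
move: hL h2 h3 h6; rewrite -/c.
move: (\sum_y mart c j s y ^+ 2) (\sum_y mart c j s y ^+ 4) => A B.
have -> : l * (1 / 128 * T * N) = 1 / 128 * (l * T * N) by ring.
have -> : l * (T / 256 * N) = 1 / 256 * (l * T * N) by ring.
by lra.
Qed.

End Gradual.

(* A 0-1 valued G which, conditionally on the parts containing y, has mean
   1/2 + walk/(2K) and is uncorrelated for x in distinct parts. *)
Record rounding_ok (R : realFieldType) (V : finType) (e : nat -> rel V)
    (a : nat -> V -> V -> R) (s K : nat) (G : V -> V -> R) : Prop :=
  RoundingOk {
  rnd_mean : forall x (psi : V -> R), inv (e s) psi ->
    \sum_y psi y * (G x y - (1 / 2 + walk a K s x y / (2 * K%:R))) = 0;
  rnd_pair : forall x x' (psi : V -> R), inv (e s) psi -> ~~ e s x x' ->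
    \sum_y psi y * ((G x y - (1 / 2 + walk a K s x y / (2 * K%:R))) *
      (G x' y - (1 / 2 + walk a K s x' y / (2 * K%:R)))) = 0;
  rnd_le : forall x y,
    `|G x y - (1 / 2 + walk a K s x y / (2 * K%:R))| <= 1 }.

(** * Tests of the rounded densities *)

Section Rounded.
Variables (R : rcfType) (V : finType).
Variables (e : nat -> rel V) (a : nat -> V -> V -> R) (s K : nat).
Variable G : V -> V -> R.
Hypothesis L : level_ok e a s.
Hypothesis K0 : (0 < K)%N.
Hypothesis slow : (s%:R / K%:R ^+ 2 : R) <= 1 / 100.
Hypothesis RO : rounding_ok e a s K G.
Variable mu : V -> R.
Hypothesis mu_ge0 : forall x, 0 <= mu x.
Hypothesis mu_sum : \sum_x mu x = 1.
Implicit Types (x y : V) (i j n : nat).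

Local Notation N := (#|V|%:R : R).
Local Notation walk := (walk a K).
Local Notation live := (live a K).
Local Notation step := (step a).
Local Notation coll := (collision e).
Local Notation cell := (cell e mu).
Local Notation mart := (mart a K).
Local Notation tail := (tail e s mu).

Definition rnd_err x y := G x y - (1 / 2 + walk s x y / (2 * K%:R)).

Lemma two_K_gt0 : (0 : R) < 2 * K%:R.
Proof. by rewrite mulr_gt0 // ltr0n. Qed.

Lemma sum_centred_G (c : V -> R) y : \sum_x c x = 0 ->
  2 * K%:R * (\sum_x c x * G x y) =
  \sum_x c x * walk s x y + 2 * K%:R * \sum_x c x * rnd_err x y.
Proof.
move=> c0; rewrite !mulr_sumr -big_split.
have z : \sum_x K%:R * c x = 0 by rewrite -mulr_sumr c0 mulr0.
rewrite -[RHS]addr0 -[X in _ = _ + X]z -big_split; apply: eq_bigr => x _ /=.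
rewrite /rnd_err; have := two_K_gt0; move: (K%:R : R) (walk s x y) (G x y) => k w g k0.
by field; apply/eqP => k1; move: k0; rewrite k1; lra.
Qed.

(** The walk term is the conditional expectation, on parts of level s, of the rounded one, so
    rounding cannot decrease the L1 norm. *)
Lemma gradual_test_rounded j : (0 < #|V|)%N -> (j.+1 < s)%N ->
  (forall x, cell j.+1 x <= 3 / 4) -> 1 / 200 ^+ 2 <= tail j ->
  exists u : V -> R, [/\ forall x, `|u x| <= 2,
    \sum_x mu x * u x = 0 &
    1 / 10 ^+ 13 * N <= 2 * K%:R * \sum_y `|\sum_x mu x * u x * G x y|].
Proof.
move=> V0 js hw hT.
have [u [u2 u0 hu]] := gradual_test L K0 slow mu_ge0 mu_sum V0 js hw hT.
exists u; split=> //; apply: le_trans hu _.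
have -> : 2 * K%:R * \sum_y `|\sum_x mu x * u x * G x y| =
    \sum_y `|\sum_x mu x * u x * walk s x y +
      2 * K%:R * \sum_x mu x * u x * rnd_err x y|.
  rewrite mulr_sumr; apply: eq_bigr => y _; rewrite -(sum_centred_G y u0).
  by rewrite normrM (ger0_norm (ltW two_K_gt0)).
apply: (norm_sum_condexp (r := e s)).
  move=> y y' yy; apply: eq_bigr => x _.
  by rewrite (walk_inv K L (leqnn s) (lv_refl L _ x) yy).
move=> psi hpsi.
under eq_bigr => y _ do rewrite mulrCA mulr_sumr.
rewrite -mulr_sumr exchange_big big1 ?mulr0 // => x _ /=.
under eq_bigr => y _ do rewrite mulrCA.
by rewrite -mulr_sumr (rnd_mean RO) // mulr0.
Qed.

Lemma sum_rnd_err2 (c : V -> V -> R) (b : V -> R) :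
  (forall x, inv (e s) (c x)) -> (forall x y, `|c x y| <= b x) ->
  \sum_y (\sum_x c x y * rnd_err x y) ^+ 2 <= coll s b * N.
Proof.
move=> hc cb.
have b0 x : 0 <= b x by apply: le_trans (cb x x).
have -> : \sum_y (\sum_x c x y * rnd_err x y) ^+ 2 =
    \sum_x \sum_x' \sum_y (c x y * c x' y) * (rnd_err x y * rnd_err x' y).
  under [RHS]eq_bigr => x _ do rewrite exchange_big.
  rewrite [RHS]exchange_big; apply: eq_bigr => y _ /=.
  rewrite expr2 big_distrlr; apply: eq_bigr => x _; apply: eq_bigr => x' _ /=.
  by ring.
rewrite /collision mulr_suml; apply: ler_sum => x _.
rewrite mulr_suml; apply: ler_sum => x' _.
have [xx|nxx] := boolP (e s x x'); last first.
  rewrite mulr0 mul0r (rnd_pair RO) // => y y' yy.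
  by rewrite (hc x _ _ yy) (hc x' _ _ yy).
apply: le_trans (ler_norm _) _; apply: le_trans (ler_norm_sum _ _ _) _.
rewrite mulr1 mulr_natr -sumr_const; apply: ler_sum => y _.
rewrite !normrM -[leRHS]mulr1 -[X in _ <= _ * X]mulr1.
by rewrite !ler_pM ?mulr_ge0 ?(rnd_le RO).
Qed.

(* The mass is concentrated in one part of level j and dispersed at level j + 1.
   The test function is the bipartition of that part seen from the level-j part
   of y, so it may be used against any part B concentrated at level j. *)
Section Sudden.
Variables (j : nat) (x0 : V) (D : pred V).
Hypothesis js : (j < s)%N.
Hypothesis big_cell : 3 / 4 <= cell j x0.
Hypothesis small_tail : tail j <= 1 / 200 ^+ 2.
Hypothesis small_last : 4 * K%:R ^+ 2 * coll s mu <= 1 / 200 ^+ 2.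
Hypothesis large_D : 36 / 100 * N <= \sum_y (D y)%:R.

(** The imbalance under [mu] of the bipartition that the part of y induces on the part of [x0]. *)
Definition cell_avg y :=
  (\sum_x mu x * (e j x0 x)%:R * a j x y) / cell j x0.

Definition sudden_u x y := (e j x0 x)%:R * (a j x y - cell_avg y).

Lemma cell_pos : 0 < cell j x0.
Proof. by have := big_cell; lra. Qed.

Lemma cell_avg_le1 y : `|cell_avg y| <= 1.
Proof.
rewrite /cell_avg normrM normfV (ger0_norm (ltW cell_pos)).
rewrite ler_pdivrMr ?cell_pos // mul1r.
apply: le_trans (ler_norm_sum _ _ _) _; apply: ler_sum => x _.
by rewrite !normrM (norm_sign L) mulr1 !ger0_norm ?ler0n.
Qed.

Lemma cell_avg_inv : inv (e j) cell_avg.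
Proof.
move=> y y' yy; congr (_ / _); apply: eq_bigr => x _.
by rewrite (lv_inv L js (lv_refl L _ x) yy).
Qed.

Lemma sudden_u_inv x : inv (e j) (sudden_u x).
Proof.
move=> y y' yy; rewrite /sudden_u (cell_avg_inv yy).
by rewrite (lv_inv L js (lv_refl L _ x) yy).
Qed.

Lemma sudden_u_le2 x y : `|sudden_u x y| <= 2.
Proof.
rewrite normrM; apply: (@le_trans _ _ (1 * 2)); last by rewrite mul1r.
rewrite ler_pM // ?normr_nat; first by case: (e j x0 x).
apply: le_trans (ler_normB _ _) _; rewrite (norm_sign L).
by have := cell_avg_le1 y; lra.
Qed.

Lemma sudden_u_mean y : \sum_x mu x * sudden_u x y = 0.
Proof.
have -> : \sum_x mu x * sudden_u x y =
    \sum_x mu x * (e j x0 x)%:R * a j x y - cell j x0 * cell_avg y.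
  by rewrite {1}/cell mulr_suml -sumrB; apply: eq_bigr => x _;
    rewrite /sudden_u; ring.
by rewrite /cell_avg mulrC divfK ?subrr // gt_eqF // cell_pos.
Qed.

(** The bipartition is nearly balanced on average: distinct parts of level j + 1 contribute at most
    1/4 by [lv_row], and equal ones only the collision probability, bounded by [tail j]. *)
Lemma sum_cell_avg2 : \sum_y cell_avg y ^+ 2 <= 251 / 1000 * N.
Proof.
set w := cell j x0; have w0 : 0 < w := cell_pos.
pose nu x := mu x * (e j x0 x)%:R.
have nu0 x : 0 <= nu x by rewrite mulr_ge0.
have E : w ^+ 2 * \sum_y cell_avg y ^+ 2 =
    \sum_x \sum_x' nu x * nu x' * \sum_y a j x y * a j x' y.
  under [RHS]eq_bigr => x _ do
    (under eq_bigr => x' _ do rewrite mulr_sumr; rewrite exchange_big).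
  rewrite [RHS]exchange_big mulr_sumr; apply: eq_bigr => y _ /=.
  rewrite -exprMn mulrC /cell_avg divfK ?gt_eqF // expr2 big_distrlr.
  by apply: eq_bigr => x _; apply: eq_bigr => x' _ /=; rewrite /nu; ring.
have h : w ^+ 2 * \sum_y cell_avg y ^+ 2 <=
    (coll j.+1 mu + 1 / 4 * w ^+ 2) * N.
  rewrite E; apply: (@le_trans _ _ (\sum_x \sum_x'
      (mu x * mu x' * (e j.+1 x x')%:R + 1 / 4 * (nu x * nu x')) * N)).
    apply: ler_sum => x _; apply: ler_sum => x' _.
    have N0 : 0 <= N by rewrite ler0n.
    rewrite /nu; have [xx|_] := boolP (e j x0 x); last first.
      rewrite !(mulr0, mul0r) addr0; apply: mulr_ge0 => //.
      by rewrite !mulr_ge0.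
    have [xx'|_] := boolP (e j x0 x'); last first.
      rewrite !(mulr0, mul0r) addr0; apply: mulr_ge0 => //.
      by rewrite !mulr_ge0.
    rewrite !mulr1.
    have m0 : 0 <= mu x * mu x' by rewrite mulr_ge0.
    suff : \sum_y a j x y * a j x' y <= ((e j.+1 x x')%:R + 1 / 4) * N.
      move=> /(ler_wpM2l m0) hh; apply: le_trans hh _.
      by rewrite le_eqVlt; apply/orP; left; apply/eqP; ring.
    have [ee|ne] := boolP (e j.+1 x x').
      have -> : \sum_y a j x y * a j x' y = N.
        rewrite (eq_bigr (fun=> 1)) ?sumr_const // => y _.
        by rewrite -(lv_inv L js ee (lv_refl L j y)) (lv_sq L).
      by rewrite /=; lra.
    have exx' : e j x x'.
      by apply: (lv_trans L) xx'; rewrite (lv_sym L).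
    have := lv_row L js exx' ne; have := ler_norm (\sum_y a j x y * a j x' y).
    by rewrite /=; lra.
  rewrite le_eqVlt; apply/orP; left; apply/eqP.
  have -> : w ^+ 2 = \sum_x \sum_x' nu x * nu x'.
    by rewrite expr2 /w /cell big_distrlr.
  rewrite /collision mulr_sumr -big_split mulr_suml.
  apply: eq_bigr => x _ /=.
  by rewrite mulr_sumr -big_split mulr_suml; apply: eq_bigr => x' _ /=; ring.
have p0 : coll j.+1 mu <= 1 / 200 ^+ 2.
  apply: le_trans small_tail; rewrite /tail big_ltn ?ltnS //.
  by rewrite lerDl sumr_ge0 // => i _; rewrite collision_ge0.
have w2 : 9 / 16 <= w ^+ 2.
  have -> : 9 / 16 = (3 / 4) ^+ 2 :> R by field.
  by rewrite lerXn2r ?nnegrE //; [lra|apply: ltW].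
have N0 : 0 <= N by rewrite ler0n.
have A0 : 0 <= \sum_y cell_avg y ^+ 2 by apply: sumr_ge0 => y _; rewrite sqr_ge0.
have w20 : 0 < w ^+ 2 by rewrite exprn_gt0.
rewrite -(ler_pM2l w20); apply: le_trans h _.
rewrite [leRHS]mulrA ler_wpM2r //; lra.
Qed.

(** In 2K times the tested sum, the levels before j cancel by centring, level j gives the variance
    of the bipartition, and the later levels and the rounding are the noise terms [n1] and [n2]. *)
Lemma sudden_test :
  1 / 20 * N <= \sum_y (D y)%:R *
    (2 * K%:R * `|\sum_x mu x * sudden_u x y * G x y|).
Proof.
set c := fun x y => mu x * sudden_u x y.
have c_inv x : inv (e j) (c x).
  by move=> y y' /(sudden_u_inv x) h; rewrite /c h.
have cb x y : `|c x y| <= 2 * mu x.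
  rewrite /c normrM (ger0_norm (mu_ge0 x)) mulrC ler_wpM2r //.
  exact: sudden_u_le2.
have eC i : coll i (fun x => 2 * mu x) = 4 * coll i mu.
  rewrite /collision mulr_sumr; apply: eq_bigr => x _.
  by rewrite mulr_sumr; apply: eq_bigr => x' _; ring.
set n1 := mart c j.+1 s; set n2 := fun y => \sum_x c x y * rnd_err x y.
have N0 : 0 <= N by rewrite ler0n.
have b1 : \sum_y n1 y ^+ 2 <= 4 / 200 ^+ 2 * N.
  have hc1 x : inv (e j.+1) (c x) by apply: (inv_le L) (c_inv x); rewrite ?leqnSn.
  apply: le_trans (mart2 K L js (leqnn s) hc1 cb) _.
  rewrite ler_wpM2r // (eq_bigr _ (fun i _ => eC i)) -mulr_sumr.
  have : \sum_(j.+1 <= i < s) coll i mu <= tail j.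
    by rewrite /tail big_nat_recr //= lerDl collision_ge0.
  by have := small_tail; lra.
have b2 : \sum_y (2 * K%:R * n2 y) ^+ 2 <= 4 / 200 ^+ 2 * N.
  have hcs x : inv (e s) (c x) by apply: (inv_le L) (c_inv x); rewrite ?(ltnW js).
  have h := sum_rnd_err2 hcs cb.
  under eq_bigr => y _ do rewrite exprMn.
  rewrite -mulr_sumr; apply: (@le_trans _ _ ((2 * K%:R) ^+ 2 *
    (coll s (fun x => 2 * mu x) * N))).
    by rewrite ler_wpM2l // sqr_ge0.
  rewrite eC mulrA ler_wpM2r //.
  have -> : (2 * K%:R) ^+ 2 * (4 * coll s mu) =
    4 * (4 * K%:R ^+ 2 * coll s mu) by ring.
  by have := small_last; lra.
have main y : 2 * K%:R * (\sum_x c x y * G x y) =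
    live j x0 y * a j y x0 * (cell j x0 * (1 - cell_avg y ^+ 2)) +
    (n1 y + 2 * K%:R * n2 y).
  rewrite (sum_centred_G y (sudden_u_mean y)) addrA; congr (_ + _).
  have -> : \sum_x c x y * walk s x y = \sum_x c x y * walk j x y +
      \sum_x c x y * (live j x y * step j x y) + n1 y.
    rewrite /n1 /mart -!big_split; apply: eq_bigr => x _ /=.
    by rewrite walkS; ring.
  congr (_ + _).
  have z : \sum_x c x y * walk j x y = 0.
    transitivity ((\sum_x c x y) * walk j x0 y).
      rewrite mulr_suml; apply: eq_bigr => x _; rewrite /c /sudden_u.
      have [xx|_] := boolP (e j x0 x); last by rewrite !(mul0r, mulr0).
      by rewrite (walk_inv K L (ltnW js) xx (lv_refl L j y)).
    by rewrite sudden_u_mean mul0r.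
  rewrite z add0r.
  transitivity (live j x0 y * a j y x0 * \sum_x c x y * a j x y).
    rewrite mulr_sumr; apply: eq_bigr => x _; rewrite /c /sudden_u.
    have [xx|_] := boolP (e j x0 x); last by rewrite !(mul0r, mulr0).
    rewrite -(live_inv K L (ltnW js) xx (lv_refl L j y)) /step.
    by rewrite (lv_inv L js (lv_refl L _ y) xx); ring.
  congr (_ * _).
  have av : \sum_x mu x * (e j x0 x)%:R * a j x y = cell j x0 * cell_avg y.
    by rewrite /cell_avg mulrC divfK // gt_eqF // cell_pos.
  transitivity (cell j x0 - cell_avg y * (cell j x0 * cell_avg y)); last by ring.
  rewrite -av /cell mulr_sumr -sumrB; apply: eq_bigr => x _.
  transitivity (mu x * (e j x0 x)%:R * (a j x y * a j x y) -
    cell_avg y * (mu x * (e j x0 x)%:R * a j x y)).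
    by rewrite /c /sudden_u; ring.
  by rewrite (lv_sq L) mulr1.
have low y : 3 / 4 * ((D y)%:R - (1 - live j x0 y) - cell_avg y ^+ 2) -
    (1 / 100 + 50 * (n1 y ^+ 2 + (2 * K%:R * n2 y) ^+ 2)) <=
    (D y)%:R * (2 * K%:R * `|\sum_x c x y * G x y|).
  have -> : 2 * K%:R * `|\sum_x c x y * G x y| =
      `|2 * K%:R * (\sum_x c x y * G x y)|.
    by rewrite normrM (ger0_norm (ltW two_K_gt0)).
  have av2 : cell_avg y ^+ 2 <= 1.
    by rewrite -(real_normK (num_real _)) exprn_ile1 // cell_avg_le1.
  have av0 := sqr_ge0 (cell_avg y).
  have l0 := live_ge0 a K j x0 y; have l1 := live_le1 a K j x0 y.
  have q1 := sqr_ge0 (n1 y); have q2 := sqr_ge0 (2 * K%:R * n2 y).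
  have [Dy|_] := boolP (D y); last first.
    by rewrite mul0r /=; lra.
  rewrite mul1r main.
  set A := _ * (_ * _); set B := n1 y + _.
  have hA : `|A| = live j x0 y * (cell j x0 * (1 - cell_avg y ^+ 2)).
    rewrite /A !normrM (norm_sign L) mulr1 (ger0_norm l0).
    by rewrite (ger0_norm (ltW cell_pos)) ger0_norm // subr_ge0.
  have hA2 : 3 / 4 * (1 - (1 - live j x0 y) - cell_avg y ^+ 2) <= `|A|.
    rewrite hA mulrCA.
    have h1 : 1 - (1 - live j x0 y) - cell_avg y ^+ 2 <=
        live j x0 y * (1 - cell_avg y ^+ 2).
      by move: av0 av2 l0 l1; move: (cell_avg y ^+ 2) (live j x0 y) => p q; nra.
    have h2 : 0 <= live j x0 y * (1 - cell_avg y ^+ 2).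
      by rewrite mulr_ge0 // subr_ge0.
    have := ler_wpM2r h2 big_cell; lra.
  (* By t <= 1/100 + 25 t^2 the noise enters only through its second moment. *)
  have hB : `|B| <= 1 / 100 + 50 * (n1 y ^+ 2 + (2 * K%:R * n2 y) ^+ 2).
    rewrite /B; move: (n1 y) (2 * K%:R * n2 y) => p q.
    have h1 : (p + q) ^+ 2 <= 2 * (p ^+ 2 + q ^+ 2).
      by have := sqr_ge0 (p - q); rewrite !expr2; lra.
    have h2 : `|p + q| <= 1 / 100 + 25 * (p + q) ^+ 2.
      have := sqr_ge0 (`|p + q| - 1 / 50).
      rewrite -(real_normK (num_real (p + q))) !expr2.
      by move: (`|p + q|) => t; lra.
    by lra.
  have := lerB_normD A B; rewrite /=; lra.
apply: le_trans (ler_sum _ (fun y _ => low y)).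
have E : \sum_y (3 / 4 * ((D y)%:R - (1 - live j x0 y) - cell_avg y ^+ 2) -
    (1 / 100 + 50 * (n1 y ^+ 2 + (2 * K%:R * n2 y) ^+ 2))) =
    3 / 4 * (\sum_y (D y)%:R - \sum_y (1 - live j x0 y) -
       \sum_y cell_avg y ^+ 2) - (1 / 100 * N + 50 * (\sum_y n1 y ^+ 2 +
       \sum_y (2 * K%:R * n2 y) ^+ 2)).
  have hN : 1 / 100 * N = \sum_(y : V) 1 / 100.
    by rewrite sumr_const -[RHS]mulr_natr.
  rewrite hN -big_split -!sumrB !mulr_sumr -big_split -sumrB.
  by apply: eq_bigr => y _.
(* Numerically, 3/4 (0.36 - 0.01 - 0.251) - 0.01 - 50 * 8 / 200^2 > 1/20. *)
rewrite E.
have hl := sum_live_ge L K0 slow x0 (ltnW js).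
have hl' : \sum_y (1 - live j x0 y) = N - \sum_y live j x0 y.
  by rewrite sumrB sumr_const.
have := sum_cell_avg2; have := large_D.
by rewrite hl'; lra.
Qed.

End Sudden.
End Rounded.

(** * The lower bound for all partitions *)

Lemma exists_drop (P : pred nat) s : P 0%N -> ~~ P s ->
  exists2 j, (j < s)%N & P j && ~~ P j.+1.
Proof.
elim: s => [|s IH] P0; first by rewrite P0.
move=> nPs; have [Ps|/(IH P0) [j js hj]] := boolP (P s).
  by exists s => //; rewrite Ps.
by exists j => //; apply: leq_trans js _.
Qed.

Section Core.
Variables (R : rcfType) (V I : finType).
Variables (e : nat -> rel V) (a : nat -> V -> V -> R) (s K m nI : nat).
Variables (G : V -> V -> R) (f : V -> I) (T : I -> I -> R).
Hypothesis L : level_ok e a s.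
Hypothesis K0 : (0 < K)%N.
Hypothesis slow : (s%:R / K%:R ^+ 2 : R) <= 1 / 100.
Hypothesis RO : rounding_ok e a s K G.
Hypothesis V0 : (0 < #|V|)%N.
Hypothesis card_cell : forall x, (\sum_y (e s x y)%:R) * m%:R = #|V|%:R :> R.
Hypothesis fine : forall x y, f x = f y -> e 0%N x y.
Hypothesis few : (#|[set f x | x : V]| <= nI)%N.
Hypothesis large_m : 400 * 200 ^+ 2 * K%:R ^+ 2 * nI%:R <= m%:R :> R.
(** Irregularity enters only through this property of [T], which also leaves room for the loops that
    rounding may create. *)
Hypothesis T_test : forall A B (u : V -> R), (forall x, `|u x| <= 1) ->
  (forall x, f x != A -> u x = 0) -> \sum_x u x = 0 ->
  \sum_(y | f y == B) `|\sum_x u x * G x y| <= T A B.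
Implicit Types (A B : I) (x y : V).

Local Notation N := (#|V|%:R : R).

Definition mass A : R := \sum_x (f x == A)%:R.
Definition unif A x : R := (f x == A)%:R / mass A.
Definition big_part A := N <= 100 * nI%:R * mass A.

Lemma N_gt0 : 0 < N.
Proof. by rewrite ltr0n. Qed.

Lemma mass_ge0 A : 0 <= mass A.
Proof. by apply: sumr_ge0 => x _; rewrite ler0n. Qed.

Lemma nI_gt0 : (0 < nI)%N.
Proof.
apply: leq_trans few; apply/card_gt0P; have [x _] := card_gt0P V0.
by exists (f x); apply/imsetP; exists x.
Qed.

Lemma big_mass A : big_part A -> 0 < mass A.
Proof.
move=> h; rewrite lt_neqAle mass_ge0 andbT eq_sym.
apply: contraTneq N_gt0 => m0; move: h.
by rewrite /big_part m0 mulr0 -leNgt.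
Qed.

Lemma unif_ge0 A x : 0 <= unif A x.
Proof. by rewrite divr_ge0 ?mass_ge0. Qed.

Lemma unif_sum A : big_part A -> \sum_x unif A x = 1.
Proof. by move=> /big_mass h; rewrite -mulr_suml divff // gt_eqF. Qed.

Lemma sum_by_part (P : pred I) (F : V -> R) :
  \sum_(y | P (f y)) F y = \sum_(B | P B) \sum_(y | f y == B) F y.
Proof. by rewrite (partition_big f P) //=; apply: eq_bigr => B PB;
  apply: eq_bigl => y; case: eqP => [->|]; rewrite ?PB ?andbF. Qed.

Lemma sum_mass : \sum_A mass A = N.
Proof.
rewrite exchange_big /= (eq_bigr (fun=> 1)) ?sumr_const // => x _.
rewrite (bigD1 (f x)) //= eqxx big1 ?addr0 // => A nA.
by rewrite eq_sym (negbTE nA).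
Qed.

Lemma sum_small_mass : \sum_(A | ~~ big_part A) mass A <= 1 / 100 * N.
Proof.
have n0 : (0 : R) < nI%:R by rewrite ltr0n nI_gt0.
have n100 : (0 : R) < 100 * nI%:R by rewrite mulr_gt0.
rewrite -(ler_pM2l n100) mulr_sumr.
apply: (@le_trans _ _ (\sum_(A in [set f x | x : V]) N)); last first.
  rewrite sumr_const -[leLHS]mulr_natl.
  apply: (@le_trans _ _ (nI%:R * N)); last by lra.
  by rewrite ler_wpM2r ?ler0n // ler_nat.
rewrite [leRHS]big_mkcond [leLHS]big_mkcond; apply: ler_sum => A _ /=.
have [hA|nA] := boolP (A \in _).
  by case: ifP => [|_]; rewrite ?ler0n // /big_part -ltNge => /ltW.
have -> : mass A = 0.
  rewrite /mass big1 // => x _; case: eqP => // fx; case/negP: nA.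
  by apply/imsetP; exists x.
by rewrite mulr0; case: ifP.
Qed.

(** A part of level s has N / m points and A has at least N / (100 nI), so such a part carries at
    most a fraction 100 nI / m of A. *)
Lemma cell_last A x : big_part A ->
  4 * K%:R ^+ 2 * cell e (unif A) s x <= 1 / 200 ^+ 2.
Proof.
move=> bA; have A0 := big_mass bA.
have n0 : (0 : R) < nI%:R by rewrite ltr0n nI_gt0.
have k0 : (0 : R) < K%:R ^+ 2 by rewrite exprn_gt0 // ltr0n.
have m0 : (0 : R) < m%:R.
  by apply: lt_le_trans large_m; have := mulr_gt0 k0 n0; lra.
set q := \sum_y (e s x y)%:R : R.
have hc : cell e (unif A) s x <= q / mass A.
  rewrite /q mulr_suml; apply: ler_sum => y _; rewrite /unif.
  rewrite mulrAC ler_wpM2r ?invr_ge0 ?mass_ge0 //.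
  by case: (f y == A); rewrite ?mul1r // mul0r.
apply: (@le_trans _ _ (4 * K%:R ^+ 2 * (q / mass A))).
  by rewrite ler_wpM2l // mulr_ge0 // ltW.
rewrite mulrA ler_pdivrMr // -(ler_pM2r m0).
have -> : 4 * K%:R ^+ 2 * q * m%:R = 4 * K%:R ^+ 2 * N.
  by rewrite -mulrA card_cell.
apply: (@le_trans _ _ (4 * K%:R ^+ 2 * (100 * nI%:R * mass A))).
  by rewrite ler_wpM2l // mulr_ge0 // ltW.
have := ler_wpM2l (ltW A0) large_m; rewrite -subr_ge0 => h.
by rewrite -subr_ge0; lra.
Qed.

Definition drop_at A (p : nat * V) :=
  [/\ (p.1 < s)%N, 3 / 4 <= cell e (unif A) p.1 p.2 &
      forall x, cell e (unif A) p.1.+1 x <= 3 / 4].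

(** At level 0 all of A lies in one part, by [fine]; at level s no part carries 3/4 of it. *)
Lemma exists_drop_at A : big_part A -> exists p, drop_at A p.
Proof.
move=> bA; have A0 := big_mass bA.
pose P i := [exists x, 3 / 4 <= cell e (unif A) i x].
have P0 : P 0%N.
  have [x fx] : exists x, f x == A.
    apply/existsP; apply: contraTT A0 => /existsPn h.
    by rewrite /mass big1 ?ltxx // => x _; rewrite (negbTE (h x)).
  apply/existsP; exists x.
  have -> : cell e (unif A) 0 x = 1.
    rewrite -(unif_sum bA); apply: eq_bigr => y _; rewrite /unif.
    have [fy|_] := boolP (f y == A); last by rewrite !mul0r.
    by rewrite fine ?mulr1 // (eqP fx) (eqP fy).
  by lra.
have Ps : ~~ P s.
  apply/existsPn => x; rewrite -ltNge.
  have := cell_last x bA.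
  have k1 : (1 : R) <= K%:R ^+ 2 by rewrite exprn_ege1 // ler1n.
  have := cell_ge0 e (unif_ge0 A) s x.
  move: (cell _ _ _ _) => w w0.
  have := ler_wpM2r w0 k1; lra.
have [j js /andP[/existsP[x hx] /existsPn hn]] := exists_drop P0 Ps.
by exists (j, x); split=> // y; rewrite ltW // ltNge.
Qed.

Lemma collision_last A : big_part A ->
  4 * K%:R ^+ 2 * collision e s (unif A) <= 1 / 200 ^+ 2.
Proof.
move=> bA; rewrite collision_cell mulr_sumr -[leRHS]mul1r -[X in _ <= X * _](unif_sum bA).
rewrite mulr_suml; apply: ler_sum => x _.
have -> : 4 * K%:R ^+ 2 * (unif A x * cell e (unif A) s x) =
  unif A x * (4 * K%:R ^+ 2 * cell e (unif A) s x) by ring.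
by rewrite ler_wpM2l ?unif_ge0 // cell_last.
Qed.

Lemma unif_test A B (u : V -> R) : big_part A -> (forall x, `|u x| <= 2) ->
  \sum_x unif A x * u x = 0 ->
  mass A / 2 * \sum_(y | f y == B) `|\sum_x unif A x * u x * G x y| <= T A B.
Proof.
move=> bA u2 u0; have A0 := big_mass bA.
have mA x : mass A / 2 * (unif A x * u x) = (f x == A)%:R * (u x / 2).
  by rewrite /unif; field; rewrite gt_eqF.
apply: le_trans (T_test (u := fun x => mass A / 2 * (unif A x * u x)) B _ _ _).
- rewrite mulr_sumr; apply: ler_sum => y _.
  rewrite -[X in X * _](ger0_norm (_ : 0 <= mass A / 2)); last first.
    by rewrite divr_ge0 ?mass_ge0.
  rewrite -normrM mulr_sumr; rewrite le_eqVlt; apply/orP; left; apply/eqP; congr `|_|.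
  by apply: eq_bigr => x _; rewrite !mulrA.
- move=> x; rewrite mA; case: (f x == A); last by rewrite mul0r normr0 ler01.
  have := u2 x; rewrite mul1r !ler_norml; lra.
- by move=> x /negbTE fx; rewrite mA fx mul0r.
- by rewrite -mulr_sumr u0 mulr0.
Qed.

Definition slow_part A (p : nat * V) := 1 / 200 ^+ 2 <= tail e s (unif A) p.1.

Lemma slow_part_T A p : big_part A -> drop_at A p -> slow_part A p ->
  1 / 10 ^+ 13 * N * mass A <= 4 * K%:R * \sum_B T A B.
Proof.
move=> bA [p1 hp hn] hs; have A0 := big_mass bA.
have us := unif_sum bA; have u0 := unif_ge0 A.
(* Dispersion at the last level would leave in the tail only the collision probability at level s,
   which is below the threshold. *)
have js : (p.1.+1 < s)%N.
  rewrite ltn_neqAle p1 andbT; apply: contraTneq hs => js.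
  rewrite /slow_part /tail js big_nat1 -ltNge.
  have := collision_last bA; have := collision_ge0 e s u0.
  have k1 : (1 : R) <= K%:R ^+ 2 by rewrite exprn_ege1 // ler1n.
  move: (collision _ _ _) => w w0.
  by have := ler_wpM2r w0 k1; lra.
have [u [u2 uz hu]] := gradual_test_rounded L K0 slow RO u0 us V0 js hn hs.
have : mass A / 2 * \sum_y `|\sum_x unif A x * u x * G x y| <= \sum_B T A B.
  rewrite (sum_by_part xpredT) mulr_sumr; apply: ler_sum => B _.
  exact: unif_test.
have k0 : (0 : R) < K%:R by rewrite ltr0n.
move: hu; move: (\sum_y _) (\sum_B _) => X Y h1 h2.
have := ler_wpM2l (ltW A0) h1; have := ler_wpM2l (ltW k0) h2; lra.
Qed.

Lemma sum_tests_ge : 1 / 10 ^+ 16 * N ^+ 2 <= K%:R * \sum_A \sum_B T A B.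
Proof.
have N0 := N_gt0; have k0 : (0 : R) < K%:R by rewrite ltr0n.
have [y0 _] := card_gt0P V0.
have [p hp] : exists p : I -> nat * V, forall A, big_part A -> drop_at A (p A).
  apply: (@fin_all_exists _ _ (fun A q => big_part A -> drop_at A q)) => A.
  have [/exists_drop_at[q hq]|nb] := boolP (big_part A); first by exists q.
  by exists (0%N, y0).
have T0 A B : 0 <= T A B.
  apply: le_trans (T_test (u := fun=> 0) B _ _ _).
  - by apply: sumr_ge0.
  - by move=> x; rewrite normr0 ler01.
  - by [].
  - by rewrite big1.
pose slowA A := big_part A && (1 / 200 ^+ 2 <= tail e s (unif A) (p A).1).
have hslow A : slowA A -> 1 / 10 ^+ 13 * N * mass A <= 4 * K%:R * \sum_B T A B.
  by move=> /andP[bA sA]; apply: slow_part_T (hp A bA) sA.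
have [manyslow|fewslow] := lerP (1 / 100 * N) (\sum_(A | slowA A) mass A).
  have h1 : 1 / 10 ^+ 13 * N * \sum_(A | slowA A) mass A <=
      4 * K%:R * \sum_A \sum_B T A B.
    rewrite !mulr_sumr [leLHS]big_mkcond; apply: ler_sum => A _.
    case: ifP => [/hslow //|_].
    by rewrite mulr_ge0 ?mulr_ge0 ?ler0n ?sumr_ge0.
  have N20 : 0 <= 1 / 10 ^+ 13 * N by lra.
  have := ler_wpM2l N20 manyslow.
  move: h1; move: (\sum_A \sum_B T A B) (\sum_(A | slowA A) mass A) => X Y.
  have := sqr_ge0 N; rewrite !expr2; lra.
pose quick A := big_part A && (tail e s (unif A) (p A).1 < 1 / 200 ^+ 2).
have massq : 98 / 100 * N <= \sum_(A | quick A) mass A.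
  have : N = \sum_(A | ~~ big_part A) mass A + (\sum_(A | slowA A) mass A +
      \sum_(A | quick A) mass A).
    rewrite -sum_mass (bigID big_part) /= addrC; congr (_ + _).
    rewrite (bigID (fun A => 1 / 200 ^+ 2 <= tail e s (unif A) (p A).1)) /=.
    by congr (_ + _); apply: eq_bigl => A; rewrite /quick ltNge.
  by have := sum_small_mass; lra.
pose deep t := \sum_(A | quick A && (t <= (p A).1)%N) mass A.
have deep0 : deep 0%N = \sum_(A | quick A) mass A.
  by apply: eq_bigl => A; rewrite leq0n andbT.
have deeps : deep s = 0.
  rewrite /deep big_pred0 // => A; case: (boolP (quick A)) => //= /andP[bA _].
  by have [h _ _] := hp A bA; rewrite leqNgt h.
(* t is a median of the levels at which the parts disperse. *)
have [t ts /andP[ht hnt]] : exists2 t, (t < s)%N &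
    (49 / 100 * N <= deep t) && ~~ (49 / 100 * N <= deep t.+1).
  apply: (@exists_drop (fun t => 49 / 100 * N <= deep t)).
    by rewrite deep0; lra.
  by rewrite deeps -ltNge; lra.
have shallow : 49 / 100 * N <= \sum_(A | quick A && ((p A).1 <= t)%N) mass A.
  have : \sum_(A | quick A) mass A = deep t.+1 +
      \sum_(A | quick A && ((p A).1 <= t)%N) mass A.
    rewrite (bigID (fun A => (t < (p A).1)%N)) /=; congr (_ + _).
    by apply: eq_bigl => A; rewrite -leqNgt.
  by move: hnt; rewrite -ltNge; lra.
have pairT A : quick A -> ((p A).1 <= t)%N ->
    1 / 20 * N * mass A <= 4 * K%:R * \sum_B T A B.
  move=> /andP[bA qA] At; have A0 := big_mass bA.
  have [js hx _] := hp A bA.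
  set j := (p A).1 in js hx qA At *; set x0 := (p A).2 in hx.
  (* A part B dispersing at level t or later is concentrated at its own level, hence also in one
     part of the coarser level j. This gives 3/4 of the deep mass. *)
  pose D y := quick (f y) && (t <= (p (f y)).1)%N && e j y (p (f y)).2.
  have hD : 36 / 100 * N <= \sum_y (D y)%:R.
    apply: (@le_trans _ _ (3 / 4 * deep t)); first by lra.
    have -> : \sum_y (D y)%:R = \sum_(y | quick (f y) && (t <= (p (f y)).1)%N)
       (e j y (p (f y)).2)%:R :> R.
      rewrite [RHS]big_mkcond; apply: eq_bigr => y _; rewrite /D.
      by case: (quick (f y) && (t <= (p (f y)).1)%N).
    rewrite (sum_by_part (fun B => quick B && (t <= (p B).1)%N)) /deep mulr_sumr.
    apply: ler_sum => B /andP[/andP[bB _] tB].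
    have [jBs hB _] := hp B bB; have B0 := big_mass bB.
    apply: (@le_trans _ _ (mass B * cell e (unif B) (p B).1 (p B).2)).
      by rewrite mulrC ler_wpM2l ?mass_ge0.
    rewrite /cell mulr_sumr [leRHS]big_mkcond; apply: ler_sum => y _.
    rewrite /unif mulrA mulrCA divff ?gt_eqF // mulr1.
    case: (eqVneq (f y) B) => [->|_]; last by rewrite mul0r.
    rewrite mul1r ler_nat; case: (boolP (e (p B).1 _ _)) => // ee.
    rewrite (same_part_le L (leq_trans At tB) (ltnW jBs)) //.
    by rewrite (lv_sym L).
  have := sudden_test L K0 slow RO (unif_ge0 A) js hx (ltW qA)
    (collision_last bA) hD.
  set u := sudden_u e a (unif A) j x0 => h.
  have hB B : mass A / 2 * \sum_(y | f y == B)
      (D y)%:R * `|\sum_x unif A x * u x y * G x y| <= T A B.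
    (* Within one B a single test function serves all y of [D]: it depends on y only through its
       part of level j, so [(p B).2] may replace y. *)
    apply: le_trans (@unif_test A B (fun x => u x (p B).2) bA _ _).
    - rewrite ler_wpM2l ?divr_ge0 ?mass_ge0 //; apply: ler_sum => y /eqP fy.
      have [|_] := boolP (D y); last by rewrite mul0r.
      rewrite /D fy mul1r => /andP[_ ey].
      rewrite (_ : \sum_x unif A x * u x y * G x y =
        \sum_x unif A x * u x (p B).2 * G x y) //.
      apply: eq_bigr => x _.
      by rewrite /u (sudden_u_inv L (unif A) x0 js x ey).
    - by move=> x; apply: (sudden_u_le2 L (unif_ge0 A) hx).
    - exact: (sudden_u_mean a hx).
  have hS : mass A / 2 * \sum_y (D y)%:R * `|\sum_x unif A x * u x y * G x y|
      <= \sum_B T A B.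
    rewrite (sum_by_part xpredT) mulr_sumr; apply: ler_sum => B _; exact: hB.
  have e2 : \sum_y (D y)%:R * (2 * K%:R * `|\sum_x unif A x * u x y * G x y|) =
      2 * K%:R * \sum_y (D y)%:R * `|\sum_x unif A x * u x y * G x y|.
    by rewrite mulr_sumr; apply: eq_bigr => y _; rewrite mulrCA.
  rewrite e2 in h; move: h hS; move: (\sum_y _) (\sum_B _) => X Y h1 h2.
  by have := ler_wpM2l (ltW A0) h1; have := ler_wpM2l (ltW k0) h2; lra.
have h1 : 1 / 20 * N * \sum_(A | quick A && ((p A).1 <= t)%N) mass A <=
    4 * K%:R * \sum_A \sum_B T A B.
  rewrite !mulr_sumr [leLHS]big_mkcond; apply: ler_sum => A _.
  case: ifP => [/andP[qA At]|_]; first exact: pairT.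
  by rewrite mulr_ge0 ?mulr_ge0 ?ler0n ?sumr_ge0.
have N20 : 0 <= 1 / 20 * N by lra.
have := ler_wpM2l N20 shallow.
move: h1; move: (\sum_A \sum_B T A B) (\sum_(A | quick A && _) mass A) => X Y.
have := sqr_ge0 N; rewrite !expr2; lra.
Qed.

End Core.

(** * Rounding densities to a graph *)

Lemma sum_ffun_at (R : realFieldType) (T U : finType) (z : T) (phi : U -> R) :
  \sum_t phi t = 0 -> \sum_(rho : {ffun T -> U}) phi (rho z) = 0.
Proof.
move=> h.
pose F x t := if x == z then phi t else 1.
have E (rho : {ffun T -> U}) : phi (rho z) = \prod_x F x (rho x).
  by rewrite /F -big_mkcond /= big_pred1_eq.
rewrite (eq_bigr _ (fun rho _ => E rho)).
rewrite -(bigA_distr_bigA F) (bigD1 z) //= {1}/F.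
by under eq_bigr => t _ do rewrite eqxx; rewrite h mul0r.
Qed.

Lemma sum_ffun_at2 (R : realFieldType) (T U : finType) (z z' : T)
    (phi phi' : U -> R) : z != z' ->
  \sum_t phi t = 0 ->
  \sum_(rho : {ffun T -> U}) phi (rho z) * phi' (rho z') = 0.
Proof.
move=> zz h.
pose F x t := (if x == z then phi t else 1) * (if x == z' then phi' t else 1).
have E (rho : {ffun T -> U}) : phi (rho z) * phi' (rho z') =
    \prod_x F x (rho x).
  by rewrite big_split /= -!big_mkcond /= !big_pred1_eq.
rewrite (eq_bigr _ (fun rho _ => E rho)).
rewrite -(bigA_distr_bigA F) (bigD1 z) //= {1}/F.
under eq_bigr => t _ do rewrite eqxx (negbTE zz) mulr1.
by rewrite h mul0r.
Qed.

Lemma sum_threshold (R : realFieldType) (n p : nat) (c : 'I_n.+1) :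
  (p <= n.+1)%N ->
  \sum_(t : 'I_n.+1) ((((c + t)%R : 'I_n.+1)%:R : R) < p%:R)%R%:R = p%:R :> R.
Proof.
move=> pn; rewrite (reindex_inj (addrI (- c))).
under eq_bigr => t _ do rewrite addNKr ltr_nat.
rewrite -natr_sum; congr _%:R.
rewrite (eq_bigr (fun t : 'I_n.+1 => if (t < p)%N then 1%N else 0%N)) //.
by rewrite -big_mkcond -(big_ord_widen n.+1 (fun=> 1%N) pn) sum1_card card_ord.
Qed.

Section Rounding.
Variables (R : realFieldType) (T : finType).
Variables (e : nat -> rel T) (a : nat -> T -> T -> R) (s K : nat).
Hypothesis L : level_ok e a s.
Hypothesis e_last : forall x y, e s x y = (x == y).
Hypothesis K0 : (0 < K)%N.

(** The successor form makes the addition of ['I_n.+1] available, which is addition mod 2K. *)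
Local Notation n := (2 * K).-1.
Local Notation V := (T * {ffun T -> 'I_n.+1})%type.
Local Notation e' := (fun i (x y : V) => e i x.1 y.1).
Local Notation a' := (fun i (x y : V) => a i x.1 y.1).

(* x.2 y.1 is a private random number of x attached to the part of y. *)
Definition rounded (x y : V) : bool :=
  (((x.2 y.1 + y.2 x.1)%R : 'I_n.+1)%:R : R) < K%:R + walk a K s x.1 y.1.

Lemma rounded_sym : symmetric rounded.
Proof. by move=> x y; rewrite /rounded addrC walk_sym. Qed.

Lemma walk_lift i (x y : V) : walk a' K i x y = walk a K i x.1 y.1.
Proof. by elim: i => // i IH; rewrite !walkS /live IH. Qed.

Lemma card_n : n.+1 = (2 * K)%N.
Proof. by rewrite prednK // muln_gt0. Qed.

Let err (x : V) (y : T) (t : 'I_n.+1) : R :=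
  ((((x.2 y + t)%R : 'I_n.+1)%:R : R) < K%:R + walk a K s x.1 y)%R%:R -
  (1 / 2 + walk a K s x.1 y / (2 * K%:R)).

Lemma sum_err x y : \sum_t err x y t = 0.
Proof.
have k0 : (K%:R : R) != 0 by rewrite pnatr_eq0 -lt0n.
have [p pK hp] := walk_shift_nat L K0 s x.1 y.
have hw : K%:R + walk a K s x.1 y = p%:R by rewrite addrC.
rewrite sumrB sumr_const card_ord hw sum_threshold; last by rewrite card_n.
have cn : (n.+1%:R : R) = 2 * K%:R by rewrite card_n natrM.
rewrite -[X in _ - X]mulr_natr cn -hw.
by apply/eqP; rewrite subr_eq0; apply/eqP; field.
Qed.

(** For fixed x, as y runs over the copies of one vertex, [y.2 x.1] is uniform mod 2K, and x, x' in
    distinct parts of level s read distinct coordinates. So the errors are exactly centred and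
    uncorrelated. *)
Lemma rounding_exists :
  rounding_ok e' a' s K (fun x y => (rounded x y)%:R).
Proof.
have E x y : (rounded x y)%:R - (1 / 2 + walk a' K s x y / (2 * K%:R)) =
    err x y.1 (y.2 x.1) :> R by rewrite walk_lift.
split=> [x psi hpsi|x x' psi hpsi|x y].
- under eq_bigr => y _ do rewrite E.
  rewrite sum_prod_type big1 // => y _ /=.
  have hy rho : psi (y, rho) = psi (y, x.2) by apply: hpsi; rewrite e_last.
  under eq_bigr => rho _ do rewrite hy.
  by rewrite -mulr_sumr (sum_ffun_at x.1 (sum_err x y)) mulr0.
- rewrite e_last => nxx; under eq_bigr => y _ do rewrite !E.
  rewrite sum_prod_type big1 // => y _ /=.
  have hy rho : psi (y, rho) = psi (y, x.2) by apply: hpsi; rewrite e_last.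
  under eq_bigr => rho _ do rewrite hy.
  by rewrite -mulr_sumr (sum_ffun_at2 _ nxx (sum_err x y)) mulr0.
- rewrite walk_lift.
  have k0 : (0 : R) < 2 * K%:R by rewrite mulr_gt0 // ltr0n.
  have [p pK hp] := walk_shift_nat L K0 s x.1 y.1.
  have p2 : (p%:R : R) <= 2 * K%:R by rewrite -natrM ler_nat.
  have p0 : (0 : R) <= p%:R by rewrite ler0n.
  have -> : 1 / 2 + walk a K s x.1 y.1 / (2 * K%:R) = p%:R / (2 * K%:R) :> R.
    by rewrite -hp; field; rewrite pnatr_eq0 -lt0n.
  set q := p%:R / _.
  have q0 : 0 <= q by rewrite divr_ge0 // ltW.
  have q1 : q <= 1 by rewrite ler_pdivrMr // mul1r.
  by case: (rounded x y); rewrite ler_norml /=; lra.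
Qed.

End Rounding.

Lemma graph_levels (R : realFieldType) (m0 s K : nat) :
  (forall m, (m0 <= m)%N -> (2 + m + m ^ 4 < 2 ^ (m %/ 64))%N) ->
  (0 < m0)%N -> (0 < K)%N ->
  exists (V : finType) (e : nat -> rel V) (a : nat -> V -> V -> R)
    (E : rel V) (c : V -> 'I_m0),
  [/\ level_ok e a s /\ rounding_ok e a s K (fun x y => (E x y)%:R),
      symmetric E,
      forall x, (\sum_y (e s x y)%:R) * (level_size m0 s)%:R = #|V|%:R :> R,
      forall x y, e 0%N x y = (c x == c y) &
      (level_size m0 s <= #|V|)%N].
Proof.
move=> hm m00 K0; have [T [e [a [c [L cT es e0]]]]] := levels_exist R hm s.
pose V := (T * {ffun T -> 'I_(2 * K).-1.+1})%type.
exists V, (fun i (x y : V) => e i x.1 y.1), (fun i (x y : V) => a i x.1 y.1).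
exists (@rounded R T a s K), (fun x => c x.1); split.
- by split; [apply: level_lift|apply: rounding_exists].
- exact: rounded_sym.
- move=> x; rewrite sum_prod_type /= (bigD1 x.1) //=.
  rewrite [X in _ + X]big1 => [|y yx]; last first.
    by rewrite big1 // => rho _; rewrite es eq_sym (negbTE yx).
  rewrite addr0 (eq_bigr (fun=> 1)) => [|rho _]; last by rewrite es eqxx.
  by rewrite sumr_const -natrM card_prod cT mulnC.
- by move=> x y; rewrite e0.
- by rewrite card_prod cT leq_pmulr // card_ffun expn_gt0 card_ord.
Qed.

(** * Irregularity and test functions *)

Section Irregularity.
Variables (R : realType) (G : sgraph).
Implicit Types (X Y U Z : {set G}).

Lemma edge_count_sum X Y :
  (edge_count X Y)%:R = \sum_(x in X) \sum_(y in Y) (adj x y)%:R :> R.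
Proof.
rewrite /edge_count -sum1_card natr_sum pair_big_dep /= big_mkcond.
rewrite [RHS]big_mkcond; apply: eq_bigr => -[x y] _; rewrite inE /=.
by case: (x \in X) (y \in Y) (adj x y) => [] [] [].
Qed.

Lemma irreg_ge X Y U Z : U \subset X -> Z \subset Y ->
  `|\sum_(x in U) \sum_(y in Z) ((adj x y)%:R - density R X Y)| <= irreg R X Y.
Proof.
move=> UX ZY.
have -> : \sum_(x in U) \sum_(y in Z) ((adj x y)%:R - density R X Y) =
    (edge_count U Z)%:R - #|U|%:R * #|Z|%:R * density R X Y.
  rewrite edge_count_sum.
  under eq_bigr => x _ do rewrite sumrB sumr_const.
  rewrite sumrB sumr_const; congr (_ - _).
  by rewrite -[LHS]mulr_natl -[X in _ * X = _]mulr_natl mulrA.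
apply: le_trans (le_bigmax_cond _ _ UX).
exact: (le_bigmax_cond _ (fun Z : {set G} => _) ZY).
Qed.

Lemma irreg_sum_norm X Y Z : Z \subset Y ->
  \sum_(x in X) `|\sum_(y in Z) ((adj x y)%:R - density R X Y)| <=
  2 * irreg R X Y.
Proof.
move=> ZY; pose phi x : R := \sum_(y in Z) ((adj x y)%:R - density R X Y).
rewrite -[X in X <= _]/(\sum_(x in X) `|phi x|).
pose U b := [set x in X | (0 <= phi x) == b].
have UX b : U b \subset X by apply/subsetP => x; rewrite inE => /andP[].
have h b := irreg_ge (UX b) ZY.
have -> : \sum_(x in X) `|phi x| =
    \sum_(x in U true) phi x - \sum_(x in U false) phi x.
  rewrite (bigID (fun x => 0 <= phi x)) /= -sumrN; congr (_ + _).
    apply: eq_big => [x|x /andP[_ h0]]; last by rewrite ger0_norm.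
    by rewrite inE eqb_id.
  apply: eq_big => [x|x /andP[_ h0]]; first by rewrite inE eqbF_neg.
  by rewrite ltr0_norm // ltNge.
have := h true; have := h false; rewrite -/phi !ler_norml; lra.
Qed.

(** As u has sum 0, the density may be subtracted freely. The 4 comes from splitting by sign, first
    in y and then in x. *)
Lemma irreg_test X Y (u : G -> R) : (forall x, `|u x| <= 1) ->
  (forall x, x \notin X -> u x = 0) -> \sum_x u x = 0 ->
  \sum_(y in Y) `|\sum_x u x * (adj x y)%:R| <= 4 * irreg R X Y.
Proof.
move=> u1 uX u0.
pose h y : R := \sum_x u x * (adj x y)%:R.
rewrite -[leLHS]/(\sum_(y in Y) `|h y|).
have hE y : h y = \sum_(x in X) u x * ((adj x y)%:R - density R X Y).
  rewrite [RHS]big_mkcond /=.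
  transitivity (\sum_x u x * ((adj x y)%:R - density R X Y)).
    under [RHS]eq_bigr => x _ do rewrite mulrBr.
    by rewrite sumrB -mulr_suml u0 mul0r subr0.
  by apply: eq_bigr => x _; case: ifPn => // /uX ->; rewrite mul0r.
pose Z b := [set y in Y | (0 <= h y) == b].
have ZY b : Z b \subset Y by apply/subsetP => x; rewrite inE => /andP[].
have hZ b : `|\sum_(y in Z b) h y| <= 2 * irreg R X Y.
  apply: le_trans (irreg_sum_norm X (ZY b)).
  under eq_bigr => y _ do rewrite hE.
  rewrite exchange_big /=; apply: le_trans (ler_norm_sum _ _ _) _.
  apply: ler_sum => x _; rewrite -mulr_sumr normrM.
  by rewrite -[leRHS]mul1r ler_wpM2r.
have -> : \sum_(y in Y) `|h y| = \sum_(y in Z true) h y - \sum_(y in Z false) h y.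
  rewrite (bigID (fun y => 0 <= h y)) /= -sumrN; congr (_ + _).
    apply: eq_big => [y|y /andP[_ h0]]; last by rewrite ger0_norm.
    by rewrite inE eqb_id.
  apply: eq_big => [y|y /andP[_ h0]]; first by rewrite inE eqbF_neg.
  by rewrite ltr0_norm // ltNge.
have := hZ true; have := hZ false; rewrite !ler_norml; lra.
Qed.

End Irregularity.

(** * Growth of the number of parts *)

Lemma exp_beats_poly (C d : nat) :
  exists x0, forall x, (x0 <= x)%N -> (C * x.+1 ^ d <= 2 ^ x)%N.
Proof.
exists (d.+1 * (C * d.+1 ^ d))%N => x hx.
set p := (x %/ d.+1)%N.
have hp : (C * d.+1 ^ d <= p)%N by rewrite leq_divRL // mulnC.
have h2 : (x.+1 <= d.+1 * p.+1)%N.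
  by rewrite mulnC; apply: ltn_ceil.
have pw i : (x.+1 ^ i <= (d.+1 * p.+1) ^ i)%N.
  by case: i => // i; rewrite leq_exp2r.
(* One factor p + 1 absorbs the constants, and p + 1 <= 2^p does the rest. *)
apply: (@leq_trans (p.+1 ^ d.+1)).
  apply: (@leq_trans (C * (d.+1 * p.+1) ^ d)).
    by rewrite leq_mul2l pw orbT.
  by rewrite expnMn mulnA expnS leq_mul2r (leq_trans hp) ?orbT.
apply: (@leq_trans ((2 ^ p) ^ d.+1)).
  by rewrite leq_exp2r // ltn_expl.
by rewrite -expnM leq_exp2l // leq_divM.
Qed.

Lemma code_size_exists : exists2 m0, (64 <= m0)%N &
  forall m, (m0 <= m)%N -> (2 + m + m ^ 4 < 2 ^ (m %/ 64))%N.
Proof.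
have [k0 hk] := exp_beats_poly (65 ^ 4) 4.
exists (64 * k0.+1)%N => [|m hm]; first by rewrite leq_pmulr.
have kk : (k0 <= m %/ 64)%N.
  by rewrite leq_divRL // mulnC; apply: leq_trans hm; rewrite leq_mul2l ltnW.
apply: leq_trans (hk _ kk); rewrite -expnMn.
have h : (m + 2 <= 65 * (m %/ 64).+1)%N.
  have := divn_eq m 64; have := ltn_pmod m (isT : (0 < 64)%N).
  by move: (m %/ 64)%N (m %% 64)%N => q r; lia.
apply: leq_trans (_ : ((m + 2) ^ 4 <= _)%N); last by rewrite leq_exp2r.
by rewrite !expnS expn0; nia.
Qed.

Lemma tower_gt n : (n < tower n)%N.
Proof.
elim: n => // n IH; apply: leq_ltn_trans IH _.
by rewrite /tower iterS -/(tower n) ltn_expl.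
Qed.

Lemma towerS n : tower n.+1 = (2 ^ tower n)%N.
Proof. by []. Qed.

(** The factor 64 absorbs the division by 64 in the exponent and is restored at each step by the
    factor in front. *)
Lemma level_size_tower m0 n : (64 <= m0)%N ->
  (64 * tower n <= level_size m0 n)%N.
Proof.
move=> h; elim: n => [|n IH]; first by rewrite muln1.
rewrite towerS; apply: leq_mul; first exact: leq_trans (level_size_ge _ _).
by rewrite leq_exp2l // leq_divRL // mulnC.
Qed.

(** One level of the tower is given up; the exponential so gained absorbs the polynomial factor. *)
Lemma level_size_growth m0 C : (64 <= m0)%N -> exists2 q0, (2 <= q0)%N &
  forall q, (q0 <= q)%N ->
    (C * q ^ 2 * tower (q ^ 2).-1 <= level_size m0 (q ^ 2))%N.
Proof.
move=> h; have [x0 hx] := exp_beats_poly C 2.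
exists x0.+2 => // q hq; have q0 : (0 < q)%N by lia.
have e : (q ^ 2)%N = (q ^ 2).-1.+1 by rewrite prednK // expn_gt0 q0.
set n := (q ^ 2).-1 in e *; rewrite e.
have xn : (x0 <= n)%N by rewrite -ltnS -e; nia.
have tn := tower_gt n.
apply: (@leq_trans (2 ^ tower n)).
  apply: leq_trans (hx _ (leq_trans xn (ltnW tn))).
  by rewrite -mulnA leq_mul2l expnS expn1 leq_mul ?orbT // ltnW.
apply: leq_trans (level_size_tower n.+1 h).
by rewrite towerS leq_pmull.
Qed.

(** * From irregularity of a partition to the abstract tests *)

Section Assembly.
Variables (R : realType) (V : finType) (E : rel V) (E_sym : symmetric E).

(** The rounded relation may relate a vertex to itself. *)
Definition loopless x y := (x != y) && E x y.

Lemma loopless_sym : symmetric loopless.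
Proof. by move=> x y; rewrite /loopless eq_sym E_sym. Qed.

Lemma loopless_irr : irreflexive loopless.
Proof. by move=> x; rewrite /loopless eqxx. Qed.

Definition loopless_graph := SGraph loopless_sym loopless_irr.

Variables (m0 : nat) (c : V -> 'I_m0) (P : {set {set V}}).
Hypothesis partP : partition P [set: V].

(** Intersecting the blocks with the parts of level 0 secures [fine], at the cost of a factor m0 in
    their number and m0^2 in the sum over pairs. *)
Let f x := (pblock P x, c x).

(** A label whose set is not a block carries no vertex, so 0 suffices there. The diagonal term pays
    for the removed loops. *)
Definition test_bound (A B : {set V} * 'I_m0) : R :=
  (if (A.1 \in P) && (B.1 \in P) then 4 * irreg R (G := loopless_graph) A.1 B.1
   else 0) + (A == B)%:R * mass R f A.

Lemma block_mem x : x \in pblock P x.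
Proof. by rewrite mem_pblock (cover_partition partP) inE. Qed.

Lemma block_in x : pblock P x \in P.
Proof. by rewrite pblock_mem // (cover_partition partP) inE. Qed.

Lemma test_bound_test A B (u : V -> R) : (forall x, `|u x| <= 1) ->
  (forall x, f x != A -> u x = 0) -> \sum_x u x = 0 ->
  \sum_(y | f y == B) `|\sum_x u x * (E x y)%:R| <= test_bound A B.
Proof.
move=> u1 uA u0.
have E1 y : \sum_x u x * (E x y)%:R =
    \sum_x u x * (loopless x y)%:R + u y * (E y y)%:R.
  rewrite (bigD1 y) //= [in RHS](bigD1 y) //= /loopless eqxx mulr0 add0r addrC.
  by congr (_ + _); apply: eq_bigr => x /negbTE xy; rewrite xy.
apply: (@le_trans _ _ (\sum_(y | f y == B)
    (`|\sum_x u x * (loopless x y)%:R| + `|u y|))).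
  apply: ler_sum => y _; rewrite E1; apply: le_trans (ler_normD _ _) _.
  rewrite lerD2l normrM -[leRHS]mulr1 ler_wpM2l //.
  by case: (E y y); rewrite ?normr1 ?normr0 ?ler01.
rewrite big_split /=; apply: lerD.
  case: ifP => [_|nAB].
    apply: (@le_trans _ _ (\sum_(y in B.1) `|\sum_x u x * (loopless x y)%:R|)).
      rewrite [leLHS]big_mkcond [leRHS]big_mkcond; apply: ler_sum => y _ /=.
      have [<-|_] := eqVneq (f y) B; first by rewrite block_mem.
      by case: ifP.
    apply: (irreg_test (G := loopless_graph) (X := A.1)) => // x nx.
    by apply: uA; apply: contraNneq nx => <-; exact: block_mem.
  rewrite big1 // => y /eqP fy; rewrite big1 ?normr0 // => x _.
  rewrite uA ?mul0r //; apply: contraFneq nAB => <-.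
  by rewrite -fy /= !block_in.
have [<-|nAB] := eqVneq A B; last first.
  rewrite mul0r big1 // => y /eqP fy; rewrite uA ?normr0 //.
  by rewrite fy eq_sym.
rewrite mul1r /mass big_mkcond; apply: ler_sum => y _.
by case: (f y == A).
Qed.

Lemma sum_test_bound : \sum_A \sum_B test_bound A B =
  4 * m0%:R ^+ 2 * irreg_partition R (G := loopless_graph) P + #|V|%:R.
Proof.
pose g X Y : R := if (X \in P) && (Y \in P) then
  4 * irreg R (G := loopless_graph) X Y else 0.
have -> : \sum_A \sum_B test_bound A B = \sum_(A : {set V} * 'I_m0)
    (\sum_(B : {set V} * 'I_m0) g A.1 B.1 + mass R f A).
  apply: eq_bigr => A _; rewrite big_split /=; congr (_ + _).
  rewrite (bigD1 A) //= eqxx mul1r big1 ?addr0 // => B.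
  by rewrite eq_sym => /negbTE ->; rewrite mul0r.
rewrite big_split /= sum_mass; congr (_ + _).
have gX X : \sum_(i : 'I_m0) \sum_(B : {set V} * 'I_m0) g X B.1 =
    m0%:R ^+ 2 * \sum_Y g X Y.
  rewrite sumr_const card_ord sum_prod_type /=.
  under eq_bigr => Y _ do rewrite sumr_const card_ord -mulr_natl.
  by rewrite -mulr_sumr -[LHS]mulr_natl mulrA -expr2.
rewrite sum_prod_type /= (eq_bigr _ (fun X _ => gX X)).
rewrite /irreg_partition [in RHS]big_mkcond mulr_sumr; apply: eq_bigr => X _ /=.
case: ifP => XP; last first.
  by rewrite big1 ?mulr0 // => Y _; rewrite /g XP.
rewrite [in RHS]big_mkcond !mulr_sumr; apply: eq_bigr => Y _ /=.
by rewrite /g XP /=; case: ifP => _; ring.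
Qed.

Lemma card_image_blocks : (#|[set f x | x : V]| <= #|P| * m0)%N.
Proof.
apply: (@leq_trans #|setX P [set: 'I_m0]|).
  apply: subset_leq_card; apply/subsetP => _ /imsetP[x _ ->].
  by rewrite !inE block_in.
by rewrite cardsX cardsT card_ord.
Qed.

End Assembly.

Lemma irregular_graph (R : realType) : exists2 c1 : R, 0 < c1 &
  exists2 q0, (2 <= q0)%N & forall q, (q0 <= q)%N -> exists G : sgraph,
    (0 < #|G|)%N /\ forall P : {set {set G}}, partition P [set: G] ->
      (#|P| <= tower (q ^ 2).-1)%N ->
      c1 * #|G|%:R ^+ 2 <= q%:R * irreg_partition R P.
Proof.
have [m0 m64 hm] := code_size_exists.
have m00 : (0 < m0)%N by apply: leq_trans m64.
have [q0 q2 hq] := level_size_growth (10 ^ 18 * m0) m64.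
have m0R : (1 : R) <= m0%:R by rewrite ler1n.
(* From N^2 / 10^16 <= 10 q (4 m0^2 irreg + N), where N >= 10^18 q makes the loop term
   negligible. *)
exists (1 / 10 ^+ 18 / m0%:R ^+ 2).
  rewrite divr_gt0 // ?exprn_gt0 //; lra.
exists q0 => // q qq0.
have q_gt0 : (0 < q)%N by apply: leq_trans qq0; apply: leq_trans q2.
have qR : (1 : R) <= q%:R by rewrite ler1n.
(* K = 10 q makes s / K^2 exactly 1/100. *)
set s := (q ^ 2)%N; set K := (10 * q)%N.
have K0 : (0 < K)%N by rewrite muln_gt0.
have [V [e [a [E [c [[L RO] Es cc e0 cV]]]]]] :=
  graph_levels R s hm m00 K0.
have KR : K%:R = 10 * q%:R :> R by rewrite natrM.
have sR : s%:R = q%:R ^+ 2 :> R by rewrite natrX.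
have slow : (s%:R / K%:R ^+ 2 : R) <= 1 / 100.
  rewrite KR sR le_eqVlt; apply/orP; left; apply/eqP; field.
  by rewrite gt_eqF //; lra.
have V0 : (0 < #|V|)%N.
  by apply: leq_trans cV; apply: leq_trans (level_size_ge _ _).
have size_R : 10 ^+ 18 * m0%:R * q%:R ^+ 2 * (tower s.-1)%:R <=
    (level_size m0 s)%:R :> R.
  by rewrite -!natrX -!natrM ler_nat; exact: hq.
have t1 : (1 : R) <= (tower s.-1)%:R.
  by rewrite ler1n; apply: leq_ltn_trans (tower_gt _).
exists (loopless_graph Es); split=> // P partP cP.
have few : (#|[set (pblock P x, c x) | x : V]| <= tower s.-1 * m0)%N.
  by apply: leq_trans (card_image_blocks c partP) _; rewrite leq_mul2r cP orbT.
have large : 400 * 200 ^+ 2 * K%:R ^+ 2 * (tower s.-1 * m0)%:R <=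
    (level_size m0 s)%:R :> R.
  apply: le_trans size_R; rewrite KR natrM exprMn.
  have : 0 <= m0%:R * q%:R ^+ 2 * (tower s.-1)%:R :> R.
    by rewrite !mulr_ge0 ?exprn_ge0 ?ler0n.
  by lra.
have fine x y : (pblock P x, c x) = (pblock P y, c y) -> e 0%N x y.
  by move=> [_ cxy]; rewrite e0 cxy.
have := sum_tests_ge L K0 slow RO V0 cc fine few large
  (test_bound_test Es partP).
rewrite sum_test_bound KR -[#|loopless_graph Es|]/#|V|.
set N : R := #|V|%:R; set ir := irreg_partition R P.
have N0 : 0 < N by rewrite ltr0n.
have Nq : 10 ^+ 18 * q%:R <= N.
  apply: (@le_trans _ _ (level_size m0 s)%:R); last by rewrite ler_nat.
  apply: le_trans size_R.
  have -> : 10 ^+ 18 * m0%:R * q%:R ^+ 2 * (tower s.-1)%:R =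
    10 ^+ 18 * q%:R * (m0%:R * q%:R * (tower s.-1)%:R) :> R by ring.
  rewrite -[leLHS]mulr1 ler_wpM2l //; first by rewrite mulr_ge0 ?exprn_ge0.
  by rewrite !mulr_ege1.
move=> h.
have h2 := ler_wpM2r (ltW N0) Nq.
have m2 : 0 < m0%:R ^+ 2 :> R by rewrite exprn_gt0 // ltr0n.
rewrite mulrAC ler_pdivrMr //.
have N2 : 0 <= N ^+ 2 by rewrite sqr_ge0.
rewrite -expr2 in h2.
have e1 : 10 * q%:R * (4 * m0%:R ^+ 2 * ir + N) =
  40 * (q%:R * ir * m0%:R ^+ 2) + 10 * (q%:R * N) by ring.
rewrite e1 in h; rewrite -mulrA in h2.
move: h h2; move: (q%:R * ir * _) (q%:R * N) (N ^+ 2) N2 => X Y Z Z0.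
by lra.
Qed.

(** * Partitions into one part *)

Section Clique.
Variables (n k : nat).

(** A clique on k of n vertices. For k near n / sqrt 2 the density is near 1/2 and the irregularity
    of the whole vertex set near n^2 / 4, which covers every [eps] below 1/4. *)
Definition clique_adj (x y : 'I_n) := [&& x != y, (x < k)%N & (y < k)%N].

Lemma clique_sym : symmetric clique_adj.
Proof. by move=> x y; rewrite /clique_adj eq_sym [in RHS]andbC -!andbA; case: (y == x); case: (x < k)%N; case: (y < k)%N. Qed.

Lemma clique_irr : irreflexive clique_adj.
Proof. by move=> x; rewrite /clique_adj eqxx. Qed.

Definition clique_graph := SGraph clique_sym clique_irr.

Lemma sum_clique (R : realFieldType) : (k <= n)%N ->
  \sum_(x : 'I_n) \sum_(y : 'I_n) (clique_adj x y)%:R = k%:R ^+ 2 - k%:R :> R.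
Proof.
move=> kn.
have C : \sum_(y : 'I_n) (y < k)%N%:R = k%:R :> R.
  rewrite -natr_sum; congr _%:R.
  rewrite (eq_bigr (fun t : 'I_n => if (t < k)%N then 1%N else 0%N)) //.
  by rewrite -big_mkcond -(big_ord_widen n (fun=> 1%N) kn) sum1_card card_ord.
have row (x : 'I_n) : \sum_(y : 'I_n) (clique_adj x y)%:R =
    (x < k)%N%:R * k%:R - (x < k)%N%:R :> R.
  rewrite -{1}C mulr_sumr (bigD1 x) //= [in RHS](bigD1 x) //=.
  rewrite {1}/clique_adj eqxx /= add0r.
  have -> : (x < k)%N%:R * (x < k)%N%:R = (x < k)%N%:R :> R.
    by case: (x < k)%N; rewrite ?mulr1 ?mulr0.
  rewrite addrAC subrr add0r; apply: eq_bigr => y yx.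
  by rewrite /clique_adj eq_sym yx -natrM mulnb.
by rewrite (eq_bigr _ (fun x _ => row x)) sumrB -mulr_suml C expr2.
Qed.

Lemma irreg_clique (R : realType) : (0 < n)%N -> (k <= n)%N ->
  (k%:R ^+ 2 - k%:R) * (1 - k%:R ^+ 2 / n%:R ^+ 2) <=
  irreg R (G := clique_graph) [set: 'I_n] [set: 'I_n].
Proof.
move=> n0 kn.
pose C := [set x : 'I_n | (x < k)%N].
have cC : #|C|%:R = k%:R :> R.
  rewrite -sum1_card natr_sum big_mkcond /=.
  rewrite (eq_bigr (fun y : 'I_n => if (y < k)%N then 1 else 0)); last first.
    by move=> y _; rewrite inE.
  rewrite -big_mkcond -(big_ord_widen n (fun=> 1) kn) sumr_const.
  by rewrite card_ord.
have all : \sum_(x : 'I_n) \sum_(y : 'I_n) (clique_adj x y)%:R =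
    k%:R ^+ 2 - k%:R :> R by apply: sum_clique.
have dens : density R (G := clique_graph) [set: 'I_n] [set: 'I_n] =
    (k%:R ^+ 2 - k%:R) / n%:R ^+ 2.
  rewrite /density edge_count_sum cardsT card_ord -expr2 -all; congr (_ / _).
  by rewrite big_mkcond; apply: eq_bigr => x _; rewrite inE big_mkcond;
    apply: eq_bigr => y _; rewrite inE.
have S d : \sum_(x in C) \sum_(y in C) ((clique_adj x y)%:R - d) =
    k%:R ^+ 2 - k%:R - k%:R ^+ 2 * d :> R.
  under eq_bigr => x _ do rewrite sumrB sumr_const.
  rewrite sumrB sumr_const -all; congr (_ - _).
    rewrite big_mkcond; apply: eq_bigr => x _ /=.
    rewrite inE; case: ifP => xk; last first.
      by rewrite big1 // => y _; rewrite /clique_adj xk andbF.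
    rewrite big_mkcond; apply: eq_bigr => y _ /=.
    by rewrite inE; case: ifP => // yk; rewrite /clique_adj yk !andbF.
  by rewrite -[LHS]mulr_natl -[X in _ * X = _]mulr_natl cC mulrA -expr2.
set D := density R (G := clique_graph) [set: 'I_n] [set: 'I_n].
have h : `|k%:R ^+ 2 - k%:R - k%:R ^+ 2 * D| <=
    irreg R (G := clique_graph) [set: 'I_n] [set: 'I_n].
  by rewrite -S; exact: (irreg_ge R (G := clique_graph) (subsetT C) (subsetT C)).
apply: le_trans h; apply: le_trans (ler_norm _); rewrite /D dens.
by rewrite le_eqVlt; apply/orP; left; apply/eqP; ring.
Qed.

End Clique.

Lemma partition_le1 (T : finType) (P : {set {set T}}) (x : T) :
  partition P [set: T] -> (#|P| <= 1)%N -> P = [set [set: T]].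
Proof.
move=> partP; have xP : pblock P x \in P.
  by rewrite pblock_mem // (cover_partition partP) inE.
rewrite leq_eqVlt ltnS leqn0 => /orP[/cards1P[X eP]|]; last first.
  by rewrite cards_eq0 => /eqP e; rewrite e inE in xP.
have := cover_partition partP; rewrite eP /cover big_set1 => ->.
by [].
Qed.

Lemma one_part_insufficient (R : realType) (eps : R) : eps < 1 / 4 ->
  ~ suffices eps 1.
Proof.
move=> eps4 suf.
(* The lower-order loss is at most 2n, which must fit into (1/4 - eps) n^2. *)
pose n := (Num.truncn (2 / (1 / 4 - eps))).+1.
have d0 : 0 < 1 / 4 - eps by lra.
have hn : 2 < (1 / 4 - eps) * n%:R.
  rewrite mulrC -ltr_pdivrMr //.
  have z0 : 0 <= 2 / (1 / 4 - eps) by rewrite divr_ge0 // ltW.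
  by have /andP[] := truncn_itv z0.
have [k kn /andP[k1 k2]] : exists2 k, (k < n.+1)%N &
    (2 * k ^ 2 <= n ^ 2)%N && ~~ (2 * k.+1 ^ 2 <= n ^ 2)%N.
  apply: (@exists_drop (fun k => 2 * k ^ 2 <= n ^ 2)%N) => //.
  by rewrite -ltnNge !expnS !expn0; nia.
have [P [partP cP hP]] := suf (clique_graph n k).
have eP := partition_le1 (ord0 : 'I_n) partP cP.
rewrite eP /irreg_partition !big_set1 in hP.
have := irreg_clique R (isT : (0 < n)%N) kn.
move: hP; rewrite card_ord => h1 h2; have {h1 h2} := le_trans h2 h1.
have n1 : (1 : R) <= n%:R by rewrite ler1n.
have k1R : 2 * k%:R ^+ 2 <= n%:R ^+ 2 :> R.
  by rewrite -!natrX -natrM ler_nat.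
have k2R : n%:R ^+ 2 < 2 * (k%:R + 1) ^+ 2 :> R.
  by rewrite natr1 -!natrX -natrM ltr_nat ltnNge.
move: k1R k2R.
have k0 : (0 : R) <= k%:R by rewrite ler0n.
have kn' : (k%:R : R) <= n%:R by rewrite ler_nat.
have kk : (0 : R) <= k%:R ^+ 2 - k%:R.
  by rewrite -natrX subr_ge0 ler_nat; case: (k) => // k'; rewrite expnS expn1 leq_pmulr.
move: (n%:R : R) (k%:R : R) hn n1 k0 kn' kk => N A hn n1 k0 kn' kk h1 h2 h3.
have N2 : 0 < N ^+ 2 by rewrite exprn_gt0 //; lra.
have half : 1 / 2 <= 1 - A ^+ 2 / N ^+ 2.
  have : A ^+ 2 / N ^+ 2 <= 1 / 2 by rewrite ler_pdivrMr //; lra.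
  by lra.
have h4 := ler_wpM2l kk half.
have N0 : 0 <= N by lra.
have h5 := ler_wpM2r N0 (ltW hn).
have h6 : 2 * N < (1 / 4 - eps) * N * N by rewrite ltr_pM2r //; lra.
by move: h1 h2 h3 h4 h6; rewrite !expr2; lra.
Qed.

Theorem theorem1p2 (R : realType) :
  exists2 c : R, 0 < c &
    forall eps : R, 0 < eps -> eps < 1 / 4%:R ->
    forall M : nat, is_M eps M ->
    exists n : nat,
      [/\ (0 < n)%N, c * eps ^- 2 <= n%:R & (tower n <= M)%N].
Proof.
have [c1 c10 [q0 q02 hq]] := irregular_graph R.
have q0R : (2 : R) <= q0%:R by rewrite ler_nat.
have q2 : 0 < q0%:R ^+ 2 :> R by rewrite exprn_gt0 //; lra.
(* With z = c1 / (2 eps) below, the bound c eps^-2 is z^2 / (8 q0^2). It is at most 1 for z < q0,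
   where n = 1 is taken, and at most q^2 - 1 with q the integer part of z otherwise. *)
exists (c1 ^+ 2 / (32 * q0%:R ^+ 2)).
  by apply: divr_gt0; [exact: exprn_gt0|lra].
move=> eps eps0 eps4 M [M0 sufM _].
(* The 2 creates the final contradiction: too few parts would give c1 <= q eps, while q eps <= z eps
   = c1 / 2. *)
pose z := c1 / (2 * eps).
have z0 : 0 < z by apply: divr_gt0 => //; lra.
have ez : eps ^-1 = 2 * z / c1.
  by rewrite /z; field; rewrite !gt_eqF.
rewrite -exprVn ez.
have cz : c1 ^+ 2 / (32 * q0%:R ^+ 2) * (2 * z / c1) ^+ 2 =
    z ^+ 2 / (8 * q0%:R ^+ 2).
  by field; rewrite !gt_eqF //; lra.
have q8 : 0 < 8 * q0%:R ^+ 2 :> R by lra.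
rewrite cz.
have [zq|qz] := ltrP z q0%:R.
  exists 1%N; split=> //.
    rewrite ler_pdivrMr // mul1r.
    have : z ^+ 2 <= q0%:R ^+ 2.
      by rewrite lerXn2r ?nnegrE //; exact: ltW.
    by lra.
  rewrite ltnNge; apply/negP => M1.
  apply: (one_part_insufficient (eps := eps)) => // G.
  by have [P [h1 h2 h3]] := sufM G; exists P; split=> //; apply: leq_trans M1.
pose q := Num.truncn z.
have /andP[qz1 qz2] := truncn_itv (ltW z0).
have q0q : (q0 <= q)%N.
  by rewrite -ltnS -(ltr_nat R); apply: le_lt_trans qz2.
exists (q ^ 2).-1; split.
- by have := leq_trans q02 q0q; case: (q) => [|[|r]] //.
- rewrite ler_pdivrMr //.
  have q2' : (2 : R) <= q%:R by rewrite ler_nat (leq_trans q02).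
  have -> : (q ^ 2).-1%:R = q%:R ^+ 2 - 1 :> R.
    by rewrite -subn1 natrB ?natrX // expn_gt0 -(ltr_nat R); lra.
  move: qz2; rewrite -natr1 => qz2.
  have h1 : z ^+ 2 <= (q%:R + 1) ^+ 2.
    by rewrite lerXn2r ?nnegrE //; [exact: ltW|lra|exact: ltW].
  have h2 : 4 <= q0%:R ^+ 2 :> R.
    have -> : (4 : R) = 2 ^+ 2 by ring.
    by rewrite lerXn2r ?nnegrE //; lra.
  have h3 : 0 <= q%:R ^+ 2 - 1 :> R by rewrite subr_ge0 exprn_ege1 //; lra.
  have h4 := ler_wpM2l h3 h2.
  move: (q%:R : R) q2' h1 h3 h4 => r r2 h1 h3 h4.
  have h5 := mulr_ge0 (_ : 0 <= r - 2) (_ : 0 <= r - 2).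
  have {}h5 : 0 <= (r - 2) * (r - 2) by apply: h5; lra.
  by move: h1 h3 h4 h5; rewrite !expr2; lra.
- have [G [G0 hG]] := hq q q0q.
  rewrite leqNgt; apply/negP => MT.
  have [P [partP cP hP]] := sufM G.
  have := hG P partP (leq_trans cP (ltnW MT)).
  have N0 : 0 < #|G|%:R ^+ 2 :> R by rewrite exprn_gt0 // ltr0n.
  move=> h; have h1 := ler_wpM2l (ler0n R q) hP.
  have {h h1} := le_trans h h1.
  rewrite [leRHS]mulrA ler_pM2r // => h1.
  have h2 := ler_wpM2r (ltW eps0) qz1.
  have h3 : z * eps = c1 / 2 by rewrite /z; field; rewrite gt_eqF.
  by move: h1 h2; rewrite h3; lra.
Qed.
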